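(* Let $p\ge1$ be an integer, $K\in[1,\infty)$, and let $F$ be a $K$-quasiregular polyharmonic mapping in the unit disk $\mathbb{D}$ of the form $$F(z)=\sum_{n=1}^{p}|z|^{2(n-1)}\big(h_n(z)+\overline{g_n(z)}\big)=\sum_{n=1}^{p}|z|^{2(n-1)}\sum_{j=1}^{\infty}\big(a_{n,j}z^{j}+\overline{b_{n,j}}\,\overline{z}^{j}\big),$$ with $\lambda_F(0)=\alpha>0$ and $l_F(1)<\infty$. Suppose that for all $j\ge 1$ and $n_1,n_2\in\{1,\dots,p\}$, $$\left|\arg\left\{\frac{a_{n_1,j}}{a_{n_2,j}}\right\}\right|=0\quad\text{whenever } a_{n_1,j},a_{n_2,j}\neq 0,\qquad \left|\arg\left\{\frac{b_{n_1,j}}{b_{n_2,j}}\right\}\right|=0\quad\text{whenever } b_{n_1,j},b_{n_2,j}\ne 0.$$ Then $F$ is univalent in the disk $\mathbb{D}_{r_2}$ and $F(\mathbb{D}_{r_2})$ contains a univalent disk $\mathbb{D}_{\rho_2}$, where $r_2$ is the least positive root of the equation $$\alpha-\frac{K\,l_F(1)}{2\pi(1-r)}\left(r+3\sum_{n=2}^{p}r^{2(n-1)}\right)=0,$$ and $$\rho_2=\alpha r_2-\frac{K\,l_F(1)}{2\pi}\left(\log\frac{1}{1-r_2}-r_2+2\log\frac{1}{1-r_2}\sum_{n=2}^{p}r_2^{2(n-1)}\right).$$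
   Context: $\mathbb{D}_r=\{z\in\mathbb{C}:|z|<r\}$ and $\mathbb{D}=\mathbb{D}_1$. A complex-valued mapping $F$ is polyharmonic ($p$-harmonic) in a domain if $\Delta^pF=0$ there, where $\Delta=4\,\partial^2/\partial z\partial\overline z$. In the displayed form, $h_n(z)=\sum_{j\ge1}a_{n,j}z^j$ and $g_n(z)=\sum_{j\ge1}b_{n,j}z^j$ are analytic in $\mathbb{D}$ with complex coefficients. Put $\lambda_F(z)=\big||F_z(z)|-|F_{\overline z}(z)|\big|$ and $\Lambda_F(z)=|F_z(z)|+|F_{\overline z}(z)|$. $F$ is $K$-quasiregular, $K\in[1,\infty)$, if $\Lambda_F(z)\le K\lambda_F(z)$ for all $z\in\mathbb{D}$. For $r\in[0,1)$, $$l_F(r)=r\int_0^{2\pi}\big|F_z(re^{i\theta})-e^{-2i\theta}F_{\overline z}(re^{i\theta})\big|\,d\theta,$$ and $l_F(1)=\sup_{0<r<1}l_F(r)$. $\arg$ denotes the principal argument in $(-\pi,\pi]$. ''Univalent'' means injective; ''$F(\mathbb{D}_{r_2})$ contains a univalent disk $\mathbb{D}_{\rho_2}$'' means that $\mathbb{D}_{\rho_2}\subset F(\mathbb{D}_{r_2})$ is the injective image under $F$ of a subset of $\mathbb{D}_{r_2}$. Empty sums (for $p=1$) are $0$. *)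

(* Defs.v *)
(* Stdlib reals with Coquelicot. *)
From Stdlib Require Export Reals Lra Lia.
From Coquelicot Require Export Coquelicot.

Open Scope R_scope.

Definition disk (r : R) (z : C) : Prop := Cmod z < r.

(* [cis t] is exp(i t). *)
Definition cis (t : R) : C := (cos t, sin t).

(* Principal argument in (-PI, PI]; the value at 0 is junk (see [Carg_spec]). *)
Definition Carg (z : C) : R :=
  if Rle_dec 0 (Im z) then acos (Re z / Cmod z) else - acos (Re z / Cmod z).

(* The partial derivatives of F = u + i v in x and y, where z = x + i y. They
   are total functions, meaningful where u and v have partial derivatives. *)
Definition Cdx (F : C -> C) (z : C) : C :=
  (Derive (fun x => Re (F (x, Im z))) (Re z),
   Derive (fun x => Im (F (x, Im z))) (Re z)).

Definition Cdy (F : C -> C) (z : C) : C :=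
  (Derive (fun y => Re (F (Re z, y))) (Im z),
   Derive (fun y => Im (F (Re z, y))) (Im z)).

Definition dz (F : C -> C) (z : C) : C :=
  ((Cdx F z - Ci * Cdy F z) / 2)%C.

Definition dzbar (F : C -> C) (z : C) : C :=
  ((Cdx F z + Ci * Cdy F z) / 2)%C.

Definition laplacian (F : C -> C) (z : C) : C := (4 * dz (dzbar F) z)%C.

Definition ex_partials (F : C -> C) (z : C) : Prop :=
  ex_derive (fun x => Re (F (x, Im z))) (Re z) /\
  ex_derive (fun x => Im (F (x, Im z))) (Re z) /\
  ex_derive (fun y => Re (F (Re z, y))) (Im z) /\
  ex_derive (fun y => Im (F (Re z, y))) (Im z).

(* F is of class C^k, in the real sense, on the open set D. *)
Fixpoint Ck_on (k : nat) (D : C -> Prop) (F : C -> C) : Prop :=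
  (forall z : C, D z -> continuous F z) /\
  match k with
  | O => True
  | S k' => (forall z : C, D z -> ex_partials F z) /\
            Ck_on k' D (Cdx F) /\ Ck_on k' D (Cdy F)
  end.

(* C^(2p) regularity makes the total operator [laplacian] the genuine one in
   all p iterations. *)
Definition polyharmonic (p : nat) (D : C -> Prop) (F : C -> C) : Prop :=
  Ck_on (2 * p) D F /\
  forall z : C, D z -> Nat.iter p laplacian F z = RtoC 0.

Definition lambda (F : C -> C) (z : C) : R :=
  Rabs (Cmod (dz F z) - Cmod (dzbar F z)).

Definition Lambda (F : C -> C) (z : C) : R :=
  Cmod (dz F z) + Cmod (dzbar F z).

Definition quasiregular (K : R) (F : C -> C) : Prop :=
  forall z : C, disk 1 z -> Lambda F z <= K * lambda F z.

(* The length of the image of the circle of radius r < 1 about 0. *)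
Definition circle_length (F : C -> C) (r : R) : R :=
  r * RInt (fun t => Cmod (dz F (r * cis t) - cis (- 2 * t) * dzbar F (r * cis t))%C)
           0 (2 * PI).

(* The value at r = 1, possibly infinite, is the supremum over 0 < r < 1. *)
Definition circle_length_1 (F : C -> C) : Rbar :=
  Lub_Rbar (fun x => exists r : R, 0 < r < 1 /\ x = circle_length F r).

Definition univalent_on (F : C -> C) (U : C -> Prop) : Prop :=
  forall z w : C, U z -> U w -> F z = F w -> z = w.

Definition contains_univalent_disk (F : C -> C) (r rho : R) : Prop :=
  0 < rho /\
  exists U : C -> Prop,
    (forall z : C, U z -> disk r z) /\
    univalent_on F U /\
    (forall w : C, disk rho w <-> exists z : C, U z /\ F z = w).

(* [f] is only considered on [D], the set where its formula makes sense. *)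
Definition least_positive_root (D : R -> Prop) (f : R -> R) (r : R) : Prop :=
  (0 < r /\ D r /\ f r = 0) /\
  forall s : R, 0 < s -> D s -> f s = 0 -> r <= s.

Lemma Carg_spec (z : C) :
  z <> RtoC 0 -> - PI < Carg z <= PI /\ z = (Cmod z * cis (Carg z))%C.
Proof.
intros Hz.
assert (Hm : 0 < Cmod z) by now apply Cmod_gt_0.
assert (H2 : Cmod z ^ 2 = Re z ^ 2 + Im z ^ 2) by apply Cmod2_alt.
set (m := Cmod z) in *.
assert (Hc : Re z / m * m = Re z) by (field; lra).
set (c := Re z / m) in *.
assert (Hc1 : -1 <= c <= 1).
{ assert (Re z <= m /\ - m <= Re z).
  { pose proof (re_le_Cmod z) as H. fold m in H.
    unfold Rabs in H; destruct (Rcase_abs (Re z)); lra. }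
  split; nra. }
assert (Hs : m * sqrt (1 - c * c) = Rabs (Im z)).
{ rewrite <- (sqrt_Rsqr m) at 1 by lra.
  rewrite <- sqrt_mult; [|unfold Rsqr; nra|nra].
  rewrite <- sqrt_Rsqr_abs. f_equal. unfold Rsqr.
  rewrite <- Hc in H2. nra. }
pose proof (acos_bound c) as Hb.
assert (Hcos : cos (acos c) = c) by now apply cos_acos.
assert (Hsin : sin (acos c) = sqrt (1 - c * c)) by now apply sin_acos.
pose proof PI_RGT_0.
unfold Carg. fold m c.
destruct (Rle_dec 0 (Im z)) as [Hi|Hi]; unfold cis;
  rewrite ?cos_neg, ?sin_neg, Hcos, Hsin.
- split; [lra|].
  rewrite Rabs_pos_eq in Hs by lra.
  rewrite (surjective_pairing z) at 1.
  unfold Cmult, RtoC; simpl; f_equal; unfold Re, Im in *; nra.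
- rewrite Rabs_left in Hs by lra. split.
  + split; [|lra].
    destruct (Req_dec (acos c) PI) as [E|E]; [|lra].
    rewrite E in Hsin. rewrite sin_PI in Hsin. rewrite <- Hsin in Hs. lra.
  + rewrite (surjective_pairing z) at 1.
    unfold Cmult, RtoC; simpl; f_equal; unfold Re, Im in *; nra.
Qed.

(* Main.v *)
Require Import Defs.
From Stdlib Require Import Reals.
From Coquelicot Require Import Coquelicot.
From Stdlib Require Import Classical Compare_dec.

(** Put M = K L / (2 PI), c(n,j) = |a(n,j)| + |b(n,j)| and
    S(r) = r^2 + r^4 + ... + r^(2(p-1)).

    The heart of the proof is the coefficient estimate (n - 1 + j) c(n,j) <= M
    ([coefficient_bound]). On the circle |z| = r the functions z F_z and
    conj z F_zbar are (r F_r - i F_t) / 2 and (r F_r + i F_t) / 2, F_r and F_t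
    being the polar derivatives. Quasiregularity gives
    |F_z| + |F_zbar| <= K | |F_z| - |F_zbar| | <= K |F_z - exp(-2it) F_zbar|, so the
    integral over the circle of |z F_z| + |conj z F_zbar| is at most K L. Testing
    z F_z against u exp(-ijt) and conj z F_zbar against conj v exp(ijt), |u| = |v| = 1,
    and integrating by parts in t leaves r Q' + j Q <= 2 K L ([moment_derivative_le]),
    where Q(r) is the integral over the circle of
    Re ((u exp(-ijt) + conj v exp(ijt)) F). By the series for F, Q is made
    of the j-th coefficients only ([is_RInt_multiplier_series]); since for fixed j
    the numbers a(n,j) have a common argument, and the b(n,j) too, one choice of u
    and v turns all of them into their moduli, and
    Q(r) = 2 PI (sum over n of c(n,j) r^(2(n-1)+j)) ([moment_almansi]). Thus
    r Q' + j Q is a sum of nonnegative terms, each of them at most 2 K L; r -> 1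
    gives the estimate. Treating a and b in one integral is what keeps the
    constant K L rather than 2 L.

    The rest is perturbation theory. Write F as its linear part
    A z = a(1,1) z + conj (b(1,1) z) plus a remainder. As F_z and F_zbar at 0 are
    a(1,1) and conj b(1,1) ([lambda_at_0]), A expands distances at least by the
    factor alpha. Summed over all other coefficients, the estimate bounds the
    Lipschitz constant of the remainder on |z| <= r by M (r + 2 S(r)) / (1 - r)
    ([remainder_lipschitz]) and its size by M (log (1/(1-r)) - r + log (1/(1-r)) S(r))
    ([remainder_bound]). For r < r2 the first bound is smaller than alpha by the
    equation that defines r2, so A dominates the remainder and F is injective
    ([univalent_on_disk]). For the same reason z = A^(-1) (w - remainder z) is a
    fixed-point problem for a contraction, and it maps the closed disk of radius r
    into itself as soon as |w| + (size of the remainder) <= alpha r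
    ([covers_point]); every w in the disk of radius rho2 satisfies this for r close
    to r2. *)

(* [ring] over C, up to finite sums taken in the Coquelicot monoid of C. *)
Ltac Cring :=
  repeat match goal with
  | |- context [@sum_n C_AbelianMonoid ?f ?n] =>
      let X := fresh in
      pose (X := (@sum_n C_AbelianMonoid f n : C));
      change (@sum_n C_AbelianMonoid f n) with X; clearbody X
  | |- context [@sum_n_m C_AbelianMonoid ?f ?m ?n] =>
      let X := fresh in
      pose (X := (@sum_n_m C_AbelianMonoid f m n : C));
      change (@sum_n_m C_AbelianMonoid f m n) with X; clearbody X
  end;
  match goal with |- @eq _ ?x ?y => change (@eq C x y); ring end.

(** * Finite sums and complex series *)

Lemma sum_n_m_le_range (f g : nat -> R) (m n : nat) :
  (forall k, (m <= k <= n)%nat -> f k <= g k) ->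
  sum_n_m (G := R_AbelianMonoid) f m n <= sum_n_m (G := R_AbelianMonoid) g m n.
Proof.
intros H; induction n as [|n IH].
- destruct m as [|m].
  + rewrite !sum_n_n; apply H; lia.
  + rewrite !sum_n_m_zero by lia; apply Rle_refl.
- destruct (Nat.le_gt_cases m (S n)) as [Hm|Hm].
  + rewrite !sum_n_Sm by lia.
    apply Rplus_le_compat; [apply IH; intros; apply H; lia|apply H; lia].
  + rewrite !sum_n_m_zero by lia; apply Rle_refl.
Qed.

Lemma sum_n_m_nonneg (f : nat -> R) (m n : nat) :
  (forall k, (m <= k <= n)%nat -> 0 <= f k) ->
  0 <= sum_n_m (G := R_AbelianMonoid) f m n.
Proof.
intros H.
apply Rle_trans with (sum_n_m (G := R_AbelianMonoid) (fun _ => 0) m n).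
- rewrite (sum_n_m_const_zero (G := R_AbelianMonoid)); apply Rle_refl.
- now apply sum_n_m_le_range.
Qed.

Lemma term_le_sum_n_m (f : nat -> R) (m n i : nat) :
  (forall k, (m <= k <= n)%nat -> 0 <= f k) -> (m <= i <= n)%nat ->
  f i <= sum_n_m (G := R_AbelianMonoid) f m n.
Proof.
intros H Hi.
assert (Hs : 0 <= sum_n_m (G := R_AbelianMonoid) f (S i) n)
  by (apply sum_n_m_nonneg; intros; apply H; lia).
rewrite (sum_n_m_Chasles f m i n) by lia.
destruct i as [|i].
- replace m with 0%nat by lia. rewrite sum_n_n. unfold plus; simpl; lra.
- assert (Hp : 0 <= sum_n_m (G := R_AbelianMonoid) f m i)
    by (apply sum_n_m_nonneg; intros; apply H; lia).
  rewrite sum_n_Sm by lia. unfold plus; simpl in *; lra.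
Qed.

Lemma Cmod_sum_n_m_le (f : nat -> C) (m n : nat) :
  Cmod (sum_n_m (G := C_AbelianMonoid) f m n)
  <= sum_n_m (G := R_AbelianMonoid) (fun k => Cmod (f k)) m n.
Proof.
exact (norm_sum_n_m (K := C_AbsRing) (V := C_NormedModule) f m n).
Qed.

Lemma Cmod_sum_n_le (f : nat -> C) (n : nat) :
  Cmod (sum_n (G := C_AbelianMonoid) f n)
  <= sum_n (G := R_AbelianMonoid) (fun k => Cmod (f k)) n.
Proof. apply Cmod_sum_n_m_le. Qed.

(** Lets conjugation, rotations and the embedding of R in C pass through finite
    sums. *)
Lemma sum_n_m_additive {G H : AbelianMonoid} (phi : G -> H) (f : nat -> G)
    (m n : nat) :
  phi zero = zero -> (forall x y, phi (plus x y) = plus (phi x) (phi y)) ->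
  phi (sum_n_m f m n) = sum_n_m (fun k => phi (f k)) m n.
Proof.
intros H0 Hp; induction n as [|n IH].
- destruct m; [now rewrite !sum_n_n|now rewrite !sum_n_m_zero by lia].
- destruct (Nat.le_gt_cases m (S n)) as [Hm|Hm].
  + now rewrite !sum_n_Sm, Hp, IH by lia.
  + now rewrite !sum_n_m_zero by lia.
Qed.

(** Limits for [Cmod]: the uniform structure of C is that of the product R * R,
    whose balls are squares. *)
Definition Cmod_converges (s : nat -> C) (l : C) : Prop :=
  forall eps : R, 0 < eps ->
    exists N, forall n, (N <= n)%nat -> Cmod (s n - l)%C < eps.

Lemma is_series_Cmod_converges (f : nat -> C) (l : C) :
  is_series (K := C_AbsRing) (V := C_NormedModule) f l <->
  Cmod_converges (sum_n (G := C_AbelianMonoid) f) l.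
Proof.
unfold is_series.
rewrite (filterlim_locally_ball_norm (K := C_AbsRing) (U := C_NormedModule)).
split.
- intros H eps He. exact (H (mkposreal eps He)).
- intros H eps. exact (H eps (cond_pos eps)).
Qed.

(** Closed disks are closed; this is the way all bounds on partial sums and
    iterates pass to their limits below. *)
Lemma Cmod_converges_bound (s : nat -> C) (l c : C) (B : R) (N : nat) :
  Cmod_converges s l ->
  (forall n, (N <= n)%nat -> Cmod (s n - c)%C <= B) -> Cmod (l - c)%C <= B.
Proof.
intros Hs HB. apply Rnot_lt_le; intros Hlt.
destruct (Hs (Cmod (l - c)%C - B)) as [N1 HN1]; [lra|].
specialize (HN1 (max N N1) ltac:(lia)).
specialize (HB (max N N1) ltac:(lia)).
set (x := s (max N N1)) in *.
assert (Cmod (l - c)%C <= Cmod (x - c)%C + Cmod (x - l)%C); [|lra].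
replace (l - c)%C with ((x - c) + - (x - l))%C by Cring.
rewrite <- (Cmod_opp (x - l)%C). apply Cmod_triangle.
Qed.

Lemma is_series_C_bound (f : nat -> C) (l : C) (B : R) :
  is_series (K := C_AbsRing) (V := C_NormedModule) f l ->
  (forall n, sum_n (G := R_AbelianMonoid) (fun k => Cmod (f k)) n <= B) ->
  Cmod l <= B.
Proof.
intros Hf HB. apply is_series_Cmod_converges in Hf.
replace l with (l - 0)%C by Cring.
apply (Cmod_converges_bound _ _ _ _ 0 Hf); intros n _.
replace (sum_n (G := C_AbelianMonoid) f n - 0)%C
  with (sum_n (G := C_AbelianMonoid) f n) by Cring.
eapply Rle_trans; [apply Cmod_sum_n_le|apply HB].
Qed.

Lemma is_series_C_tail (f : nat -> C) (g : nat -> R) (l : C) (m : R) (N : nat) :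
  is_series (K := C_AbsRing) (V := C_NormedModule) f l ->
  is_series g m -> (forall k, Cmod (f k) <= g k) ->
  Cmod (l - sum_n (G := C_AbelianMonoid) f N)%C <= m - sum_n g N.
Proof.
intros Hf Hg Hfg. apply is_series_Cmod_converges in Hf.
assert (Hg0 : forall k, 0 <= g k)
  by (intros k; eapply Rle_trans; [apply Cmod_ge_0|apply Hfg]).
apply (Cmod_converges_bound _ _ _ _ N Hf); intros n Hn.
apply Rle_trans with (sum_n g n - sum_n g N).
- induction Hn as [|n Hn IH].
  + replace (_ - _)%C with (RtoC 0) by Cring. rewrite Cmod_0. lra.
  + rewrite !sum_Sn. unfold plus; simpl.
    replace (sum_n (G := C_AbelianMonoid) f n + f (S n)
             - sum_n (G := C_AbelianMonoid) f N)%C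
      with ((sum_n (G := C_AbelianMonoid) f n
             - sum_n (G := C_AbelianMonoid) f N) + f (S n))%C by Cring.
    eapply Rle_trans; [apply Cmod_triangle|]. specialize (Hfg (S n)). lra.
- apply Rplus_le_compat_r.
  apply (is_lim_seq_incr_compare (sum_n g) m Hg).
  intros k. rewrite sum_Sn. unfold plus; simpl. specialize (Hg0 (S k)). lra.
Qed.

Lemma is_series_Cconj (f : nat -> C) (l : C) :
  is_series (K := C_AbsRing) (V := C_NormedModule) f l ->
  is_series (K := C_AbsRing) (V := C_NormedModule) (fun k => Cconj (f k)) (Cconj l).
Proof.
rewrite !is_series_Cmod_converges. intros H eps He.
destruct (H eps He) as [N HN]. exists N; intros n Hn.
unfold sum_n.
rewrite <- (sum_n_m_additive (G := C_AbelianMonoid) (H := C_AbelianMonoid) Cconj).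
- rewrite <- Cminus_conj, Cmod_conj. now apply HN.
- unfold Cconj, zero; simpl. now rewrite Ropp_0.
- intros x y. apply Cplus_conj.
Qed.

Lemma is_series_sum_n_m {K : AbsRing} {V : NormedModule K}
    (f : nat -> nat -> V) (l : nat -> V) (m n : nat) :
  (forall i, (m <= i <= n)%nat -> is_series (fun k => f i k) (l i)) ->
  is_series (fun k => sum_n_m (fun i => f i k) m n) (sum_n_m l m n).
Proof.
assert (Hz : is_series (fun _ : nat => zero : V) zero).
{ unfold is_series. apply filterlim_ext with (fun _ => zero : V).
  - intros k. unfold sum_n. now rewrite sum_n_m_const_zero.
  - apply filterlim_const. }
intros H; induction n as [|n IH].
- destruct m as [|m].
  + rewrite sum_n_n. apply is_series_ext with (f 0%nat).
    * intros k. now rewrite sum_n_n.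
    * apply H; lia.
  + rewrite sum_n_m_zero by lia. apply is_series_ext with (fun _ => zero : V); [|exact Hz].
    intros k. now rewrite sum_n_m_zero by lia.
- destruct (Nat.le_gt_cases m (S n)) as [Hm|Hm].
  + rewrite sum_n_Sm by lia.
    apply is_series_ext with (fun k => plus (sum_n_m (fun i => f i k) m n) (f (S n) k)).
    * intros k. now rewrite sum_n_Sm by lia.
    * apply is_series_plus; [apply IH; intros; apply H; lia|apply H; lia].
  + rewrite sum_n_m_zero by lia. apply is_series_ext with (fun _ => zero : V); [|exact Hz].
    intros k. now rewrite sum_n_m_zero by lia.
Qed.

(** Comparison with a geometric series: the terms of the series at a point of
    larger modulus are bounded. *)
Lemma power_series_abs_summable (c : nat -> C) (r : R) :
  0 <= r < 1 ->
  (forall z : C, disk 1 z ->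
     ex_series (K := C_AbsRing) (V := C_NormedModule) (fun k => c (S k) * z ^ S k)%C) ->
  ex_series (fun k => Cmod (c (S k)) * r ^ S k).
Proof.
intros Hr Hc. set (s := (r + 1) / 2).
assert (Hs : r < s < 1) by (unfold s; lra).
destruct (Hc (RtoC s)) as [l Hl].
{ unfold disk. rewrite Cmod_R, Rabs_pos_eq; lra. }
apply is_series_Cmod_converges in Hl.
assert (HB : exists B, 0 <= B /\ forall k, Cmod (c (S k)) * s ^ S k <= B).
{ destruct (filterlim_bounded (K := C_AbsRing) (V := C_NormedModule)
    (sum_n (G := C_AbelianMonoid) (fun k => c (S k) * RtoC s ^ S k)%C)) as [B HB].
  - exists l. now apply is_series_Cmod_converges in Hl.
  - assert (HB' : forall n, Cmod (sum_n (G := C_AbelianMonoid)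
       (fun k => c (S k) * RtoC s ^ S k)%C n) <= B) by exact HB.
    assert (HB0 : 0 <= B) by (eapply Rle_trans; [apply Cmod_ge_0|apply (HB' 0%nat)]).
    exists (B + B). split; [lra|]. intros k.
    assert (E : Cmod (c (S k) * RtoC s ^ S k)%C = Cmod (c (S k)) * s ^ S k).
    { rewrite Cmod_mult, Cmod_pow, Cmod_R, Rabs_pos_eq; lra. }
    rewrite <- E. destruct k as [|k].
    + specialize (HB' 0%nat). rewrite sum_O in HB'. lra.
    + pose proof (HB' k) as H1. pose proof (HB' (S k)) as H2.
      rewrite sum_Sn in H2. unfold plus in H2; simpl in H2.
      match goal with |- Cmod ?x <= _ => set (y := x) in * end.
      match type of H1 with Cmod ?x <= _ => set (w := x) in * end.
      replace y with ((w + y) + - w)%C by Cring.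
      eapply Rle_trans; [apply Cmod_triangle|]. rewrite Cmod_opp.
      apply Rplus_le_compat; assumption. }
destruct HB as [B [HB0 HB]].
apply (ex_series_le (K := R_AbsRing) (V := R_CompleteNormedModule) _ (fun k => B * (r / s) ^ S k)).
- intros k. unfold norm; simpl. unfold abs; simpl.
  assert (0 <= r ^ S k) by (apply pow_le; lra).
  rewrite Rabs_pos_eq by (apply Rmult_le_pos; [apply Cmod_ge_0|assumption]).
  assert (E : r ^ S k = s ^ S k * (r / s) ^ S k).
  { rewrite <- Rpow_mult_distr. f_equal. field. lra. }
  change (r * r ^ k) with (r ^ S k). change (r / s * (r / s) ^ k) with ((r / s) ^ S k).
  rewrite E, <- Rmult_assoc. apply Rmult_le_compat_r; [|apply HB].
  apply pow_le. apply Rdiv_le_0_compat; lra.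
- apply (ex_series_scal_l (K := R_AbsRing) (V := R_NormedModule) B (fun k => (r / s) ^ S k)).
  apply (ex_series_scal_l (K := R_AbsRing) (V := R_NormedModule) (r / s) (fun k => (r / s) ^ k)).
  exists (/ (1 - r / s)). apply is_series_geom.
  rewrite Rabs_pos_eq; [|apply Rdiv_le_0_compat; lra].
  apply Rlt_div_l; lra.
Qed.

(** * Polar calculus of C1 functions on the unit disk *)

(** The partial derivatives are explicit arguments, so that they can be the
    components of [Cdx F] and [Cdy F]. *)
Definition C1_on_disk (u ux uy : R -> R -> R) : Prop :=
  forall x y, x ^ 2 + y ^ 2 < 1 ->
    is_derive (fun s => u s y) x (ux x y) /\
    is_derive (fun s => u x s) y (uy x y) /\
    continuity_2d_pt ux x y /\ continuity_2d_pt uy x y.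

Lemma unit_disk_open (x y : R) :
  x ^ 2 + y ^ 2 < 1 -> locally_2d (fun s t => s ^ 2 + t ^ 2 < 1) x y.
Proof.
intros H.
assert (Hc : continuity_2d_pt (fun s t => s * s + t * t) x y).
{ apply continuity_2d_pt_plus; apply continuity_2d_pt_mult;
    (apply continuity_2d_pt_id1 || apply continuity_2d_pt_id2). }
destruct (Hc (mkposreal (1 - (x ^ 2 + y ^ 2)) ltac:(lra))) as [d Hd].
exists d. intros s t Hs Ht. specialize (Hd s t Hs Ht). simpl in Hd.
apply Rabs_def2 in Hd. simpl. lra.
Qed.

Lemma C1_on_disk_differentiable (u ux uy : R -> R -> R) (x y : R) :
  C1_on_disk u ux uy -> x ^ 2 + y ^ 2 < 1 ->
  differentiable_pt_lim u x y (ux x y) (uy x y).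
Proof.
intros Hu Hxy. apply filterdiff_differentiable_pt_lim.
apply (is_derive_filterdiff u x y ux (uy x y)).
- destruct (unit_disk_open x y Hxy) as [d Hd].
  exists d. intros [s t] [Hs Ht]. simpl. apply Hu. now apply Hd.
- now apply Hu.
- apply continuity_2d_pt_filterlim. now apply Hu.
Qed.

Lemma polar_sqr (r t : R) : (r * cos t) ^ 2 + (r * sin t) ^ 2 = r ^ 2.
Proof.
pose proof (sin2_cos2 t) as H. unfold Rsqr in H.
replace ((r * cos t) ^ 2 + (r * sin t) ^ 2)
  with (r ^ 2 * (sin t * sin t + cos t * cos t)) by ring.
rewrite H. ring.
Qed.

Lemma polar_in_disk (r t : R) :
  -1 < r < 1 -> (r * cos t) ^ 2 + (r * sin t) ^ 2 < 1.
Proof. intros Hr. rewrite polar_sqr. nra. Qed.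

(** The polar derivatives of the function with partial derivatives [ux] and [uy];
    both are continuous in (r, t), also at r = 0. *)
Definition radial (ux uy : R -> R -> R) (r t : R) : R :=
  cos t * ux (r * cos t) (r * sin t) + sin t * uy (r * cos t) (r * sin t).

Definition angular (ux uy : R -> R -> R) (r t : R) : R :=
  r * (- sin t * ux (r * cos t) (r * sin t) + cos t * uy (r * cos t) (r * sin t)).

Lemma is_derive_radial (u ux uy : R -> R -> R) (r t : R) :
  C1_on_disk u ux uy -> -1 < r < 1 ->
  is_derive (fun s => u (s * cos t) (s * sin t)) r (radial ux uy r t).
Proof.
intros Hu Hr. apply is_derive_Reals. unfold radial.
rewrite (Rmult_comm (cos t)), (Rmult_comm (sin t)).
apply derivable_pt_lim_comp_2d.
- apply C1_on_disk_differentiable; [assumption|now apply polar_in_disk].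
- apply is_derive_Reals. auto_derive; [trivial|ring].
- apply is_derive_Reals. auto_derive; [trivial|ring].
Qed.

Lemma is_derive_angular (u ux uy : R -> R -> R) (r t : R) :
  C1_on_disk u ux uy -> -1 < r < 1 ->
  is_derive (fun s => u (r * cos s) (r * sin s)) t (angular ux uy r t).
Proof.
intros Hu Hr. apply is_derive_Reals. unfold angular.
replace (r * _) with (ux (r * cos t) (r * sin t) * (- r * sin t)
  + uy (r * cos t) (r * sin t) * (r * cos t)) by ring.
apply derivable_pt_lim_comp_2d.
- apply C1_on_disk_differentiable; [assumption|now apply polar_in_disk].
- apply is_derive_Reals. auto_derive; [trivial|ring].
- apply is_derive_Reals. auto_derive; [trivial|ring].
Qed.

Lemma continuity_2d_pt_snd (f : R -> R) (x y : R) :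
  continuous f y -> continuity_2d_pt (fun _ s => f s) x y.
Proof.
intros Hf. apply continuity_1d_2d_pt_comp with (f := f) (g := fun _ s => s).
- now apply continuity_pt_filterlim.
- apply continuity_2d_pt_id2.
Qed.

Lemma continuity_2d_pt_continuous_snd (f : R -> R -> R) (x y : R) :
  continuity_2d_pt f x y -> continuous (fun s => f x s) y.
Proof.
intros Hf. apply continuity_pt_filterlim.
intros eps Heps. destruct (Hf (mkposreal eps Heps)) as [d Hd].
exists d. split; [apply cond_pos|]. intros s [_ Hs]. apply Hd; [|exact Hs].
rewrite Rminus_diag, Rabs_R0. apply cond_pos.
Qed.

Lemma continuity_2d_pt_polar (f : R -> R -> R) (r t : R) :
  continuity_2d_pt f (r * cos t) (r * sin t) ->
  continuity_2d_pt (fun s w => f (s * cos w) (s * sin w)) r t.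
Proof.
intros Hf. apply continuity_2d_pt_filterlim.
apply continuity_2d_pt_filterlim in Hf.
apply (filterlim_comp_2 (F := locally (r, t))
  (fun z => fst z * cos (snd z)) (fun z => fst z * sin (snd z)) f
  (G := locally (r * cos t)) (H := locally (r * sin t))).
- apply (continuity_2d_pt_filterlim (fun s w => s * cos w) r t).
  apply continuity_2d_pt_mult; [apply continuity_2d_pt_id1|].
  apply continuity_2d_pt_snd. apply continuous_cos.
- apply (continuity_2d_pt_filterlim (fun s w => s * sin w) r t).
  apply continuity_2d_pt_mult; [apply continuity_2d_pt_id1|].
  apply continuity_2d_pt_snd. apply continuous_sin.
- intros P HP. specialize (Hf P HP). destruct Hf as [d Hd].
  apply Filter_prod with (ball (r * cos t) d) (ball (r * sin t) d).
  + apply locally_ball.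
  + apply locally_ball.
  + intros x y Hx Hy. apply (Hd (x, y)). now split.
Qed.

Lemma continuity_2d_pt_radial (u ux uy : R -> R -> R) (r t : R) :
  C1_on_disk u ux uy -> -1 < r < 1 -> continuity_2d_pt (radial ux uy) r t.
Proof.
intros Hu Hr. destruct (Hu _ _ (polar_in_disk r t Hr)) as [_ [_ [Hx Hy]]].
unfold radial. apply continuity_2d_pt_plus; apply continuity_2d_pt_mult.
- apply continuity_2d_pt_snd, continuous_cos.
- now apply continuity_2d_pt_polar.
- apply continuity_2d_pt_snd, continuous_sin.
- now apply continuity_2d_pt_polar.
Qed.

Lemma continuity_2d_pt_angular (u ux uy : R -> R -> R) (r t : R) :
  C1_on_disk u ux uy -> -1 < r < 1 -> continuity_2d_pt (angular ux uy) r t.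
Proof.
intros Hu Hr. destruct (Hu _ _ (polar_in_disk r t Hr)) as [_ [_ [Hx Hy]]].
unfold angular. apply continuity_2d_pt_mult; [apply continuity_2d_pt_id1|].
apply continuity_2d_pt_plus; apply continuity_2d_pt_mult.
- apply continuity_2d_pt_snd.
  apply (continuous_opp (V := R_NormedModule)), continuous_sin.
- now apply continuity_2d_pt_polar.
- apply continuity_2d_pt_snd, continuous_cos.
- now apply continuity_2d_pt_polar.
Qed.

Lemma is_derive_trig (A B w t : R) :
  is_derive (fun s => A * cos (w * s) + B * sin (w * s)) t
    (w * (B * cos (w * t) + - A * sin (w * t))).
Proof. auto_derive; [trivial|ring]. Qed.

Lemma continuous_trig (A B w t : R) :
  continuous (fun s => A * cos (w * s) + B * sin (w * s)) t.
Proof.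
apply (ex_derive_continuous (K := R_AbsRing) (V := R_NormedModule)).
eexists. apply is_derive_trig.
Qed.

Lemma cos_sin_nat_period (j : nat) :
  cos (INR j * (2 * PI)) = 1 /\ sin (INR j * (2 * PI)) = 0.
Proof.
replace (INR j * (2 * PI)) with (0 + 2 * INR j * PI) by ring.
rewrite cos_period, sin_period. split; [apply cos_0|apply sin_0].
Qed.

Lemma continuous_on_circle (u ux uy : R -> R -> R) (r t : R) :
  C1_on_disk u ux uy -> -1 < r < 1 ->
  continuous (fun s => u (r * cos s) (r * sin s)) t.
Proof.
intros Hu Hr.
apply (ex_derive_continuous (K := R_AbsRing) (V := R_NormedModule)).
eexists. apply (is_derive_angular u ux uy r t Hu Hr).
Qed.

Definition trig_moment (A B : R) (j : nat) (u : R -> R -> R) (r : R) : R :=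
  RInt (fun t => (A * cos (INR j * t) + B * sin (INR j * t))
                 * u (r * cos t) (r * sin t)) 0 (2 * PI).

(** Differentiation under the integral sign. *)
Lemma is_derive_trig_moment (A B : R) (j : nat) (u ux uy : R -> R -> R) (r : R) :
  C1_on_disk u ux uy -> -1 < r < 1 ->
  is_derive (trig_moment A B j u) r
    (RInt (fun t => (A * cos (INR j * t) + B * sin (INR j * t)) * radial ux uy r t)
       0 (2 * PI)).
Proof.
intros Hu Hr.
set (X := fun t => A * cos (INR j * t) + B * sin (INR j * t)).
set (f := fun s t => X t * u (s * cos t) (s * sin t)).
assert (Hd : forall s t, -1 < s < 1 ->
  is_derive (fun w => f w t) s (X t * radial ux uy s t)).
{ intros s t Hs. apply (is_derive_scal (fun w => u (w * cos t) (w * sin t))).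
  now apply is_derive_radial. }
assert (Hloc : locally r (fun s => -1 < s < 1)).
{ apply (filter_and (fun s => -1 < s) (fun s => s < 1)).
  - apply open_gt. lra.
  - apply open_lt. lra. }
replace (RInt _ 0 (2 * PI)) with (RInt (fun t => Derive (fun s => f s t) r) 0 (2 * PI)).
- apply (is_derive_RInt_param f).
  + revert Hloc. apply filter_imp. intros s Hs t _. eexists. now apply Hd.
  + intros t _.
    apply continuity_2d_pt_ext_loc with (fun s w => X w * radial ux uy s w).
    * destruct Hloc as [d Hd']. exists d. intros s w Hs _. symmetry.
      apply is_derive_unique, Hd. now apply Hd'.
    * apply continuity_2d_pt_mult.
      -- apply continuity_2d_pt_snd, continuous_trig.
      -- now apply continuity_2d_pt_radial with u.
  + revert Hloc. apply filter_imp. intros s Hs.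
    apply (ex_RInt_continuous (V := R_CompleteNormedModule)). intros t _.
    apply (continuous_mult (K := R_AbsRing)); [apply continuous_trig|].
    now apply continuous_on_circle with ux uy.
- apply RInt_ext. intros t _. apply is_derive_unique. now apply Hd.
Qed.

(** Integration by parts over a full period, where the boundary terms cancel. The
    derivative of the weight of [trig_moment] is j times the weight here. *)
Lemma is_RInt_trig_angular (A B : R) (j : nat) (u ux uy : R -> R -> R) (r : R) :
  C1_on_disk u ux uy -> -1 < r < 1 ->
  is_RInt (fun t => (B * cos (INR j * t) + - A * sin (INR j * t)) * angular ux uy r t)
    0 (2 * PI) (INR j * trig_moment A B j u r).
Proof.
intros Hu Hr.
set (Y := fun t => B * cos (INR j * t) + - A * sin (INR j * t)).
set (f := fun t => u (r * cos t) (r * sin t)).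
assert (HY : forall t, is_derive Y t (INR j * (- A * cos (INR j * t) + - B * sin (INR j * t))))
  by (intros t; apply is_derive_trig).
assert (Hf : forall t, is_derive f t (angular ux uy r t))
  by (intros t; now apply is_derive_angular).
assert (HYc : forall t, continuous (fun t => INR j * (- A * cos (INR j * t) + - B * sin (INR j * t))) t).
{ intros t. apply (continuous_scal_r (K := R_AbsRing) (V := R_NormedModule)), continuous_trig. }
assert (HAc : forall t, continuous (angular ux uy r) t).
{ intros t. apply continuity_2d_pt_continuous_snd. now apply continuity_2d_pt_angular with u. }
assert (H1 : is_RInt (fun t => INR j * (- A * cos (INR j * t) + - B * sin (INR j * t)) * f t)
   0 (2 * PI) (- INR j * trig_moment A B j u r)).
{ apply is_RInt_ext with (fun t => scal (- INR j) ((A * cos (INR j * t) + B * sin (INR j * t)) * f t)).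
  - intros t _. unfold scal; simpl. unfold mult; simpl. unfold f.
    match goal with |- @eq _ ?x ?y => change (@eq R x y) end. ring.
  - apply (is_RInt_scal (V := R_NormedModule)).
    apply (RInt_correct (V := R_CompleteNormedModule)).
    apply (ex_RInt_continuous (V := R_CompleteNormedModule)). intros t _.
    apply (continuous_mult (K := R_AbsRing)); [apply continuous_trig|].
    now apply continuous_on_circle with ux uy. }
pose proof (is_RInt_scal_derive_r (V := R_CompleteNormedModule) Y f _ _ 0 (2 * PI) _
  (fun t _ => HY t) (fun t _ => Hf t) (fun t _ => HYc t) (fun t _ => HAc t) H1) as H2.
replace (INR j * trig_moment A B j u r) with
  (minus (minus (scal (Y (2 * PI)) (f (2 * PI))) (scal (Y 0) (f 0)))
         (- INR j * trig_moment A B j u r)).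
- exact H2.
- unfold minus, plus, opp, scal; simpl. unfold mult; simpl.
  unfold Y, f. destruct (cos_sin_nat_period j) as [-> ->].
  rewrite (Rmult_0_r (INR j)), cos_2PI, sin_2PI, cos_0, sin_0.
  match goal with |- @eq _ ?x ?y => change (@eq R x y) end. ring.
Qed.

(** * Fourier coefficients on circles *)

Lemma cis_plus (s t : R) : cis (s + t) = (cis s * cis t)%C.
Proof.
unfold cis, Cmult; simpl. rewrite cos_plus, sin_plus. f_equal; ring.
Qed.

Lemma cis_0 : cis 0 = RtoC 1.
Proof. unfold cis. now rewrite cos_0, sin_0. Qed.

Lemma Cmod_cis (t : R) : Cmod (cis t) = 1.
Proof.
unfold Cmod, cis; simpl. pose proof (sin2_cos2 t) as H. unfold Rsqr in H.
replace (_ + _) with 1 by lra. apply sqrt_1.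
Qed.

Lemma cis_neg (t : R) : cis (- t) = Cconj (cis t).
Proof. unfold cis, Cconj; simpl. now rewrite cos_neg, sin_neg. Qed.

Lemma cis_pow (t : R) (k : nat) : (cis t ^ k)%C = cis (INR k * t).
Proof.
induction k as [|k IH].
- simpl. now rewrite Rmult_0_l, cis_0.
- rewrite Cpow_S, IH, S_INR, <- cis_plus. f_equal. ring.
Qed.

Lemma cis_nat_period (k : nat) : cis (INR k * (2 * PI)) = RtoC 1.
Proof. unfold cis. now destruct (cos_sin_nat_period k) as [-> ->]. Qed.

Lemma is_RInt_cis_nonzero (c : C) (w : R) :
  w <> 0 -> cis (w * (2 * PI)) = RtoC 1 ->
  is_RInt (fun t => Re (c * cis (w * t))%C) 0 (2 * PI) 0.
Proof.
intros Hw Hp. destruct c as [c1 c2].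
injection Hp as Hc Hs.
set (G := fun t => (c1 * sin (w * t) + c2 * cos (w * t)) / w).
replace 0 with (minus (G (2 * PI)) (G 0)) at 2.
- apply (is_RInt_derive (V := R_CompleteNormedModule) G).
  + intros t _. unfold G. auto_derive; [trivial|]. unfold cis, Re; simpl. field. exact Hw.
  + intros t _. apply continuous_ext with
      (fun t => c1 * cos (w * t) + (- c2) * sin (w * t)).
    * intros s. unfold cis, Re; simpl. ring.
    * apply continuous_trig.
- unfold G, minus, plus, opp; simpl. rewrite Hc, Hs, (Rmult_0_r w), cos_0, sin_0. field. exact Hw.
Qed.

Lemma is_RInt_cis_zero (c : C) (w : R) :
  w = 0 -> is_RInt (fun t => Re (c * cis (w * t))%C) 0 (2 * PI) (2 * PI * Re c).
Proof.
intros ->. apply is_RInt_ext with (fun _ => Re c).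
- intros t _. rewrite Rmult_0_l, cis_0. now rewrite Cmult_1_r.
- replace (2 * PI * Re c) with (scal (2 * PI - 0) (Re c)).
  + apply (is_RInt_const (V := R_NormedModule)).
  + unfold scal; simpl. unfold mult; simpl. ring.
Qed.

(** The multiplier that extracts the Fourier coefficients of orders [j] and
    [-j] of a function at the same time. *)
Definition multiplier (u v : C) (j : nat) (t : R) : C :=
  (u * cis (- (INR j * t)) + Cconj v * cis (INR j * t))%C.

Lemma Cmod_multiplier_le (u v : C) (j : nat) (t : R) :
  Cmod (multiplier u v j t) <= Cmod u + Cmod v.
Proof.
unfold multiplier. eapply Rle_trans; [apply Cmod_triangle|].
rewrite !Cmod_mult, !Cmod_cis, Cmod_conj. lra.
Qed.

(** The product has the frequencies k - j, j - k, k + j and - k - j; only the first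
    two can vanish, and do so when k = j. *)
Lemma is_RInt_multiplier_mode (u v A B : C) (j k : nat) :
  (1 <= j)%nat -> (1 <= k)%nat ->
  is_RInt (fun t => Re (multiplier u v j t
                        * (A * cis (INR k * t) + B * cis (- (INR k * t))))%C)
    0 (2 * PI) (if Nat.eq_dec k j then 2 * PI * Re (u * A + Cconj v * B)%C else 0).
Proof.
intros Hj Hk.
apply le_INR in Hj as Hj'. apply le_INR in Hk as Hk'. simpl in Hj', Hk'.
set (p1 := INR k - INR j). set (p2 := INR j - INR k).
set (p3 := INR k + INR j). set (p4 := - INR k - INR j).
assert (P1 : cis (p1 * (2 * PI)) = RtoC 1).
{ unfold p1. replace ((INR k - INR j) * (2 * PI))
    with (INR k * (2 * PI) + - (INR j * (2 * PI))) by ring.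
  rewrite cis_plus, cis_neg, !cis_nat_period. apply injective_projections; simpl; ring. }
assert (P2 : cis (p2 * (2 * PI)) = RtoC 1).
{ unfold p2. replace ((INR j - INR k) * (2 * PI))
    with (INR j * (2 * PI) + - (INR k * (2 * PI))) by ring.
  rewrite cis_plus, cis_neg, !cis_nat_period. apply injective_projections; simpl; ring. }
assert (P3 : cis (p3 * (2 * PI)) = RtoC 1).
{ unfold p3. replace ((INR k + INR j) * (2 * PI))
    with (INR k * (2 * PI) + INR j * (2 * PI)) by ring.
  rewrite cis_plus, !cis_nat_period. apply injective_projections; simpl; ring. }
assert (P4 : cis (p4 * (2 * PI)) = RtoC 1).
{ unfold p4. replace ((- INR k - INR j) * (2 * PI))
    with (- (INR k * (2 * PI)) + - (INR j * (2 * PI))) by ring.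
  rewrite cis_plus, !cis_neg, !cis_nat_period. apply injective_projections; simpl; ring. }
apply is_RInt_ext with (fun t =>
  plus (plus (Re (u * A * cis (p1 * t))%C) (Re (u * B * cis (p4 * t))%C))
       (plus (Re (Cconj v * A * cis (p3 * t))%C) (Re (Cconj v * B * cis (p2 * t))%C))).
- intros t _. unfold p1, p2, p3, p4, multiplier.
  replace ((INR k - INR j) * t) with (INR k * t + - (INR j * t)) by ring.
  replace ((INR j - INR k) * t) with (INR j * t + - (INR k * t)) by ring.
  replace ((INR k + INR j) * t) with (INR k * t + INR j * t) by ring.
  replace ((- INR k - INR j) * t) with (- (INR k * t) + - (INR j * t)) by ring.
  rewrite !cis_plus. unfold plus; simpl. ring.
- destruct (Nat.eq_dec k j) as [E|E].
  + replace (2 * PI * _) with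
      (plus (plus (2 * PI * Re (u * A)%C) 0) (plus 0 (2 * PI * Re (Cconj v * B)%C))).
    * apply (is_RInt_plus (V := R_NormedModule));
        apply (is_RInt_plus (V := R_NormedModule)).
      -- apply is_RInt_cis_zero. unfold p1. subst k. ring.
      -- apply is_RInt_cis_nonzero; [unfold p4; lra|exact P4].
      -- apply is_RInt_cis_nonzero; [unfold p3; lra|exact P3].
      -- apply is_RInt_cis_zero. unfold p2. subst k. ring.
    * unfold plus; simpl. ring.
  + assert (Hne : INR k <> INR j) by now apply not_INR.
    replace 0 with (plus (plus 0 0) (plus 0 0)) at 2 by (unfold plus; simpl; ring).
    apply (is_RInt_plus (V := R_NormedModule));
        apply (is_RInt_plus (V := R_NormedModule));
      (apply is_RInt_cis_nonzero; [unfold p1, p2, p3, p4; lra|assumption]).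
Qed.

(** Termwise integration, justified by the normal convergence of the series. *)
Lemma is_RInt_multiplier_series (u v : C) (j : nat) (A B : nat -> C) (f : R -> C) :
  (1 <= j)%nat ->
  (forall t, is_series (K := C_AbsRing) (V := C_NormedModule)
     (fun k => A (S k) * cis (INR (S k) * t) + B (S k) * cis (- (INR (S k) * t)))%C (f t)) ->
  ex_series (fun k => Cmod (A (S k)) + Cmod (B (S k))) ->
  is_RInt (fun t => Re (multiplier u v j t * f t)%C) 0 (2 * PI)
    (2 * PI * Re (u * A j + Cconj v * B j)%C).
Proof.
intros Hj Hf [m Hm].
set (T := fun k t => (A (S k) * cis (INR (S k) * t) + B (S k) * cis (- (INR (S k) * t)))%C).
set (val := 2 * PI * Re (u * A j + Cconj v * B j)%C).
set (fN := fun N t => Re (multiplier u v j t * sum_n (G := C_AbelianMonoid) (fun k => T k t) N)%C).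
(* The integrals of the partial sums are eventually constant: only the term of
   index k = j - 1 contributes. *)
assert (HN : forall N, is_RInt (fN N) 0 (2 * PI) (if le_dec j (S N) then val else 0)).
{ induction N as [|N IH].
  - apply is_RInt_ext with (fun t => Re (multiplier u v j t * T 0%nat t)%C).
    + intros t _. unfold fN. now rewrite sum_O.
    + pose proof (is_RInt_multiplier_mode u v (A 1%nat) (B 1%nat) j 1 Hj ltac:(lia)) as H.
      destruct (Nat.eq_dec 1 j) as [E|E]; destruct (le_dec j 1); try lia; [|exact H].
      subst j. exact H.
  - apply is_RInt_ext with (fun t => plus (fN N t) (Re (multiplier u v j t * T (S N) t)%C)).
    + intros t _. unfold fN. rewrite sum_Sn. unfold plus; simpl. ring.
    + pose proof (is_RInt_multiplier_mode u v (A (S (S N))) (B (S (S N))) j (S (S N)) Hj ltac:(lia)) as H.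
      pose proof (is_RInt_plus (V := R_NormedModule) _ _ _ _ _ _ IH H) as H2.
      clear IH H.
      destruct (Nat.eq_dec (S (S N)) j) as [E|E]; destruct (le_dec j (S N));
        destruct (le_dec j (S (S N))); try lia.
      * unfold plus at 2 in H2; simpl in H2. subst j. rewrite Rplus_0_l in H2. exact H2.
      * unfold plus at 2 in H2; simpl in H2. rewrite Rplus_0_r in H2. exact H2.
      * unfold plus at 2 in H2; simpl in H2. rewrite Rplus_0_r in H2. exact H2. }
destruct (filterlim_RInt (V := R_CompleteNormedModule) fN 0 (2 * PI) eventually _
  (fun t => Re (multiplier u v j t * f t)%C) _ HN) as [If [H1 H2]].
- apply filterlim_locally. intros eps.
  set (D := Cmod u + Cmod v + 1).
  assert (HD : 0 < D) by (unfold D; pose proof (Cmod_ge_0 u); pose proof (Cmod_ge_0 v); lra).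
  assert (He : 0 < eps / D) by (apply Rdiv_lt_0_compat; [apply cond_pos|exact HD]).
  pose proof (proj1 (is_lim_seq_Reals _ _) Hm) as Hm'.
  destruct (Hm' (eps / D) He) as [N0 HN0].
  exists N0. intros N HNge t.
  assert (Htail : Cmod (f t - sum_n (G := C_AbelianMonoid) (fun k => T k t) N)%C
     <= m - sum_n (fun k => Cmod (A (S k)) + Cmod (B (S k))) N).
  { apply is_series_C_tail; [apply Hf|exact Hm|].
    intros k. unfold T. eapply Rle_trans; [apply Cmod_triangle|].
    rewrite !Cmod_mult, !Cmod_cis. lra. }
  specialize (HN0 N HNge). unfold Rdist in HN0. apply Rabs_def2 in HN0.
  unfold ball; simpl. unfold AbsRing_ball, abs, minus, plus, opp; simpl.
  change (Rabs (fN N t - Re (multiplier u v j t * f t)%C) < eps).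
  rewrite Rabs_minus_sym. unfold fN.
  replace (Re (multiplier u v j t * f t)%C - _) with
    (Re (multiplier u v j t * (f t - sum_n (G := C_AbelianMonoid) (fun k => T k t) N))%C).
  + eapply Rle_lt_trans; [apply re_le_Cmod|]. rewrite Cmod_mult.
    apply Rle_lt_trans with (D * Cmod (f t - sum_n (G := C_AbelianMonoid) (fun k => T k t) N)%C).
    * apply Rmult_le_compat_r; [apply Cmod_ge_0|].
      pose proof (Cmod_multiplier_le u v j t). unfold D. lra.
    * replace (pos eps) with (D * (eps / D)) by (field; lra).
      apply Rmult_lt_compat_l; [exact HD|].
      eapply Rle_lt_trans; [exact Htail|]. destruct HN0 as [_ HN0].
      set (s := sum_n (G := R_AbelianMonoid)
        (fun k => Cmod (A (S k)) + Cmod (B (S k))) N : R) in *.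
      change (- (eps / D) < s - (m : R)) in HN0.
      change ((m : R) - s < eps / D). lra.
  + set (S := sum_n (G := C_AbelianMonoid) (fun k => T k t) N : C).
    change (Re (multiplier u v j t * (f t - S))%C =
      Re (multiplier u v j t * f t)%C - Re (multiplier u v j t * S)%C).
    simpl. ring.
- assert (E : If = val); [|rewrite E in H2; exact H2].
  apply (filterlim_locally_unique (K := R_AbsRing) (V := R_NormedModule)
    (F := eventually) (fun N => if le_dec j (S N) then val else 0)); [exact H1|].
  apply filterlim_ext_loc with (fun _ => val); [|apply filterlim_const].
  exists j. intros N HNj. destruct (le_dec j (S N)); [reflexivity|lia].
Qed.

(** * The derivatives of the moments of a quasiregular map *)

Lemma polar_point (r t : R) : (RtoC r * cis t)%C = (r * cos t, r * sin t).
Proof. unfold cis, Cmult, RtoC; simpl. f_equal; ring. Qed.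

Lemma Cmod_polar (r t : R) : 0 <= r -> Cmod (RtoC r * cis t)%C = r.
Proof. intros Hr. rewrite Cmod_mult, Cmod_cis, Cmod_R, Rabs_pos_eq; lra. Qed.

Lemma disk_polar (r t : R) : 0 <= r < 1 -> disk 1 (RtoC r * cis t)%C.
Proof. intros Hr. unfold disk. rewrite Cmod_polar; lra. Qed.

Lemma disk_coordinates (x y : R) : x ^ 2 + y ^ 2 < 1 -> disk 1 (x, y).
Proof.
intros H. unfold disk, Cmod; simpl fst; simpl snd.
rewrite <- sqrt_1 at 1. apply sqrt_lt_1_alt. split; [nra|lra].
Qed.

Lemma continuity_2d_pt_Re_Im (F : C -> C) (x y : R) :
  continuous (T := C_UniformSpace) (U := C_UniformSpace) F (x, y) ->
  continuity_2d_pt (fun s t => Re (F (s, t))) x y /\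
  continuity_2d_pt (fun s t => Im (F (s, t))) x y.
Proof.
intros HF. split; intros eps.
- destruct (HF (fun w => Rabs (Re w - Re (F (x, y))) < eps)) as [d Hd].
  + exists eps. intros w [Hw _]. exact Hw.
  + exists d. intros s t Hs Ht. apply Hd. now split.
- destruct (HF (fun w => Rabs (Im w - Im (F (x, y))) < eps)) as [d Hd].
  + exists eps. intros w [_ Hw]. exact Hw.
  + exists d. intros s t Hs Ht. apply Hd. now split.
Qed.

Lemma Ck_on_C1_on_disk (k : nat) (F : C -> C) :
  (1 <= k)%nat -> Ck_on k (disk 1) F ->
  C1_on_disk (fun x y => Re (F (x, y)))
    (fun x y => Re (Cdx F (x, y))) (fun x y => Re (Cdy F (x, y))) /\
  C1_on_disk (fun x y => Im (F (x, y)))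
    (fun x y => Im (Cdx F (x, y))) (fun x y => Im (Cdy F (x, y))).
Proof.
intros Hk HF. destruct k as [|k]; [lia|].
destruct HF as [_ [Hp [Hx Hy]]].
assert (Hx0 : forall z : C, disk 1 z -> continuous (Cdx F) z) by (destruct k; apply Hx).
assert (Hy0 : forall z : C, disk 1 z -> continuous (Cdy F) z) by (destruct k; apply Hy).
split; intros x y Hxy; apply disk_coordinates in Hxy;
  destruct (Hp _ Hxy) as [E1 [E2 [E3 E4]]];
  pose proof (continuity_2d_pt_Re_Im _ _ _ (Hx0 _ Hxy)) as [Cx1 Cx2];
  pose proof (continuity_2d_pt_Re_Im _ _ _ (Hy0 _ Hxy)) as [Cy1 Cy2];
  repeat split; try assumption; apply Derive_correct; assumption.
Qed.

Lemma continuous_Cmod_comp (f : R -> C) (t : R) :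
  continuous (fun s => Re (f s)) t -> continuous (fun s => Im (f s)) t ->
  continuous (fun s => Cmod (f s)) t.
Proof.
intros Hr Hi.
apply continuous_ext with (fun s => sqrt (Re (f s) * Re (f s) + Im (f s) * Im (f s))).
- intros s. unfold Cmod, Re, Im. f_equal. ring.
- apply (continuous_comp (fun s => Re (f s) * Re (f s) + Im (f s) * Im (f s)) sqrt).
  + apply (continuous_plus (V := R_NormedModule));
      now apply (continuous_mult (K := R_AbsRing)).
  + apply continuous_sqrt.
Qed.

(** Makes [circle_length] a genuine integral. *)
Lemma continuous_circle_length_integrand (F : C -> C) (k : nat) (r t : R) :
  (1 <= k)%nat -> Ck_on k (disk 1) F -> -1 < r < 1 ->
  continuous (fun s => Cmod (dz F (r * cis s) - cis (- 2 * s) * dzbar F (r * cis s))%C) t.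
Proof.
intros Hk HF Hr.
destruct (Ck_on_C1_on_disk k F Hk HF) as [HU HV].
destruct (HU _ _ (polar_in_disk r t Hr)) as [_ [_ [Ux Uy]]].
destruct (HV _ _ (polar_in_disk r t Hr)) as [_ [_ [Vx Vy]]].
apply continuity_2d_pt_polar, continuity_2d_pt_continuous_snd in Ux, Uy, Vx, Vy.
assert (Hc : continuous (fun s => cos (- 2 * s)) t)
  by (apply (ex_derive_continuous (K := R_AbsRing) (V := R_NormedModule)); auto_derive; trivial).
assert (Hs : continuous (fun s => sin (- 2 * s)) t)
  by (apply (ex_derive_continuous (K := R_AbsRing) (V := R_NormedModule)); auto_derive; trivial).
set (ux := fun s => Re (Cdx F (r * cos s, r * sin s))) in *.
set (uy := fun s => Re (Cdy F (r * cos s, r * sin s))) in *.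
set (vx := fun s => Im (Cdx F (r * cos s, r * sin s))) in *.
set (vy := fun s => Im (Cdy F (r * cos s, r * sin s))) in *.
apply continuous_Cmod_comp.
- apply continuous_ext with (fun s => / 2 * ((ux s + vy s) -
    (cos (- 2 * s) * (ux s - vy s) - sin (- 2 * s) * (vx s + uy s)))).
  + intros s. rewrite polar_point. unfold ux, uy, vx, vy, dz, dzbar, Re, Im, cis; simpl. field.
  + apply (continuous_scal_r (K := R_AbsRing) (V := R_NormedModule)).
    apply (continuous_minus (V := R_NormedModule)).
    * now apply (continuous_plus (V := R_NormedModule)).
    * apply (continuous_minus (V := R_NormedModule)); apply (continuous_mult (K := R_AbsRing)); try assumption.
      -- now apply (continuous_minus (V := R_NormedModule)).
      -- now apply (continuous_plus (V := R_NormedModule)).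
- apply continuous_ext with (fun s => / 2 * ((vx s - uy s) -
    (cos (- 2 * s) * (vx s + uy s) + sin (- 2 * s) * (ux s - vy s)))).
  + intros s. rewrite polar_point. unfold ux, uy, vx, vy, dz, dzbar, Re, Im, cis; simpl. field.
  + apply (continuous_scal_r (K := R_AbsRing) (V := R_NormedModule)).
    apply (continuous_minus (V := R_NormedModule)).
    * now apply (continuous_minus (V := R_NormedModule)).
    * apply (continuous_plus (V := R_NormedModule)); apply (continuous_mult (K := R_AbsRing)); try assumption.
      -- now apply (continuous_plus (V := R_NormedModule)).
      -- now apply (continuous_minus (V := R_NormedModule)).
Qed.

(** The integral of Re (multiplier * F) over the circle of radius r, written with
    the real and imaginary parts of F. *)
Definition moment (u v : C) (j : nat) (F : C -> C) (r : R) : R :=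
  trig_moment (Re u + Re v) (Im u + Im v) j (fun x y => Re (F (x, y))) r
  - trig_moment (Im u - Im v) (Re v - Re u) j (fun x y => Im (F (x, y))) r.

(** By [is_derive_trig_moment] and [is_RInt_trig_angular] the left-hand side is the
    integral of Re (X r F_r + Y F_t), where X is the multiplier and
    Y = i (conj v exp(ijt) - u exp(-ijt)), so that X' = j Y. This is the integral of
    2 Re (u exp(-ijt) z F_z + conj v exp(ijt) conj z F_zbar), which is at most
    2 r (|F_z| + |F_zbar|); then quasiregularity applies. *)
Lemma moment_derivative_le (u v : C) (j k : nat) (K : R) (F : C -> C) (r : R) :
  (1 <= k)%nat -> Ck_on k (disk 1) F -> quasiregular K F -> 0 <= K ->
  Cmod u = 1 -> Cmod v = 1 -> 0 < r < 1 ->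
  exists d, is_derive (moment u v j F) r d /\
    r * d + INR j * moment u v j F r <= 2 * K * circle_length F r.
Proof.
intros Hk HF Hq HK Hu Hv Hr.
destruct (Ck_on_C1_on_disk k F Hk HF) as [HU HV].
assert (Hr' : -1 < r < 1) by lra.
set (A1 := Re u + Re v). set (B1 := Im u + Im v).
set (A2 := Im u - Im v). set (B2 := Re v - Re u).
set (radU := radial (fun x y => Re (Cdx F (x, y))) (fun x y => Re (Cdy F (x, y)))).
set (radV := radial (fun x y => Im (Cdx F (x, y))) (fun x y => Im (Cdy F (x, y)))).
set (angU := angular (fun x y => Re (Cdx F (x, y))) (fun x y => Re (Cdy F (x, y)))).
set (angV := angular (fun x y => Im (Cdx F (x, y))) (fun x y => Im (Cdy F (x, y)))).
set (XU := fun t => (A1 * cos (INR j * t) + B1 * sin (INR j * t)) * radU r t).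
set (XV := fun t => (A2 * cos (INR j * t) + B2 * sin (INR j * t)) * radV r t).
assert (IU : is_RInt XU 0 (2 * PI) (RInt XU 0 (2 * PI))).
{ apply (RInt_correct (V := R_CompleteNormedModule)).
  apply (ex_RInt_continuous (V := R_CompleteNormedModule)). intros t _.
  apply (continuous_mult (K := R_AbsRing)); [apply continuous_trig|].
  apply continuity_2d_pt_continuous_snd. eapply continuity_2d_pt_radial; eassumption. }
assert (IV : is_RInt XV 0 (2 * PI) (RInt XV 0 (2 * PI))).
{ apply (RInt_correct (V := R_CompleteNormedModule)).
  apply (ex_RInt_continuous (V := R_CompleteNormedModule)). intros t _.
  apply (continuous_mult (K := R_AbsRing)); [apply continuous_trig|].
  apply continuity_2d_pt_continuous_snd. eapply continuity_2d_pt_radial; eassumption. }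
exists (RInt XU 0 (2 * PI) - RInt XV 0 (2 * PI)). split.
- apply (is_derive_minus (K := R_AbsRing) (V := R_NormedModule));
    now apply is_derive_trig_moment.
- pose proof (is_RInt_trig_angular A1 B1 j _ _ _ r HU Hr') as JU.
  pose proof (is_RInt_trig_angular A2 B2 j _ _ _ r HV Hr') as JV.
  fold angU in JU. fold angV in JV.
  pose proof (is_RInt_plus (V := R_NormedModule) _ _ _ _ _ _
    (is_RInt_scal (V := R_NormedModule) _ _ _ r _
      (is_RInt_minus (V := R_NormedModule) _ _ _ _ _ _ IU IV))
    (is_RInt_minus (V := R_NormedModule) _ _ _ _ _ _ JU JV)) as J.
  set (len := fun t => Cmod (dz F (r * cis t) - cis (- 2 * t) * dzbar F (r * cis t))%C).
  assert (Hlen : is_RInt len 0 (2 * PI) (RInt len 0 (2 * PI))).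
  { apply (RInt_correct (V := R_CompleteNormedModule)).
    apply (ex_RInt_continuous (V := R_CompleteNormedModule)). intros t _.
    now apply continuous_circle_length_integrand with k. }
  pose proof (is_RInt_scal (V := R_NormedModule) _ _ _ (2 * K * r) _ Hlen) as Hlen2.
  assert (Hle := is_RInt_le _ _ _ _ _ _ (Rlt_le _ _ (Rgt_2PI_0)) J Hlen2).
  unfold scal, plus, minus, opp in Hle; simpl in Hle. unfold mult, plus, opp in Hle; simpl in Hle.
  unfold moment, circle_length. fold A1 B1 A2 B2 len.
  match type of Hle with _ -> ?a <= ?b =>
    cut (a <= b); [intros Hab; change (a <= b) in Hab; clear - Hab; lra|apply Hle] end.
  intros t _.
  (* The integrand is twice the real part of z F_z and conj z F_zbar against
     the two unimodular halves of the multiplier. *)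
  apply Rle_trans with (2 * Re (u * cis (- (INR j * t)) * (r * cis t * dz F (r * cis t))
      + Cconj v * cis (INR j * t) * (r * cis (- t) * dzbar F (r * cis t)))%C).
  + apply Req_le. unfold XU, XV, radU, radV, angU, angV, radial, angular, A1, A2, B1, B2.
    unfold dz, dzbar. rewrite polar_point.
    destruct (Cdx F (r * cos t, r * sin t)) as [a1 a2].
    destruct (Cdy F (r * cos t, r * sin t)) as [b1 b2].
    destruct u as [u1 u2]; destruct v as [v1 v2].
    unfold cis, Re, Im; simpl. rewrite !cos_neg, !sin_neg. field.
  + eapply Rle_trans; [apply Rmult_le_compat_l; [lra|]|].
    { eapply Rle_trans; [apply Rle_abs|]. eapply Rle_trans; [apply re_le_Cmod|].
      eapply Rle_trans; [apply Cmod_triangle|].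
      rewrite !Cmod_mult, !Cmod_cis, Cmod_conj, Hu, Hv, Cmod_R, (Rabs_pos_eq r) by lra.
      apply Rle_refl. }
    pose proof (Hq (r * cis t)%C (disk_polar r t ltac:(lra))) as Hqt.
    unfold Lambda, lambda in Hqt.
    assert (Hl : Rabs (Cmod (dz F (r * cis t)) - Cmod (dzbar F (r * cis t))) <= len t).
    { unfold len.
      set (x := dz F (r * cis t)). set (y := dzbar F (r * cis t)).
      replace (Cmod y) with (Cmod (cis (- 2 * t) * y)%C)
        by (rewrite Cmod_mult, Cmod_cis; ring).
      set (y' := (cis (- 2 * t) * y)%C).
      apply Rabs_le. split.
      - assert (Cmod y' <= Cmod x + Cmod (x - y')%C); [|lra].
        rewrite <- (Cmod_opp (x - y')%C).
        replace y' with (x + - (x - y'))%C at 1 by ring. apply Cmod_triangle.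
      - assert (Cmod x <= Cmod y' + Cmod (x - y')%C); [|lra].
        replace x with (y' + (x - y'))%C at 1 by ring. apply Cmod_triangle. }
    assert (Hm : Cmod (dz F (r * cis t)) + Cmod (dzbar F (r * cis t)) <= K * len t).
    { eapply Rle_trans; [exact Hqt|]. now apply Rmult_le_compat_l. }
    assert (Hm2 := Rmult_le_compat_l r _ _ (Rlt_le _ _ (proj1 Hr)) Hm).
    change (2 * (1 * 1 * (r * 1 * Cmod (dz F (r * cis t))) +
      1 * 1 * (r * 1 * Cmod (dzbar F (r * cis t)))) <= 2 * K * r * len t). lra.
Qed.

(** * Coefficient bounds *)

(** The terms of degree [j] of all the layers |z|^(2(n-1)) (h_n + conj g_n) together,
    so that F is the sum of a single series. *)
Definition almansi_term (p : nat) (a b : nat -> nat -> C) (j : nat) (z : C) : C :=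
  sum_n_m (G := C_AbelianMonoid)
    (fun n => RtoC (Cmod z ^ (2 * (n - 1))) * (a n j * z ^ j + Cconj (b n j * z ^ j)))%C 1 p.

Definition almansi_expansion (p : nat) (a b : nat -> nat -> C) (F : C -> C) : Prop :=
  (forall n, (1 <= n <= p)%nat -> forall z : C, disk 1 z ->
     ex_series (K := C_AbsRing) (V := C_NormedModule) (fun j => a n (S j) * z ^ S j)%C) /\
  (forall n, (1 <= n <= p)%nat -> forall z : C, disk 1 z ->
     ex_series (K := C_AbsRing) (V := C_NormedModule) (fun j => b n (S j) * z ^ S j)%C) /\
  (forall z : C, disk 1 z ->
     is_series (K := C_AbsRing) (V := C_NormedModule)
       (fun j => almansi_term p a b (S j) z) (F z)).

Lemma almansi_expansion_of_components (p : nat) (a b : nat -> nat -> C)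
    (h g : nat -> C -> C) (F : C -> C) :
  (forall n : nat, (1 <= n <= p)%nat -> forall z : C, disk 1 z ->
     is_series (K := C_AbsRing) (V := C_NormedModule)
       (fun j : nat => (a n (S j) * z ^ S j)%C) (h n z)) ->
  (forall n : nat, (1 <= n <= p)%nat -> forall z : C, disk 1 z ->
     is_series (K := C_AbsRing) (V := C_NormedModule)
       (fun j : nat => (b n (S j) * z ^ S j)%C) (g n z)) ->
  (forall z : C, disk 1 z ->
     F z = sum_n_m (G := C_AbelianMonoid)
       (fun n => RtoC (Cmod z ^ (2 * (n - 1))) * (h n z + Cconj (g n z)))%C 1 p) ->
  almansi_expansion p a b F.
Proof.
intros Hh Hg HF. split; [|split].
- intros n Hn z Hz. eexists. now apply Hh.
- intros n Hn z Hz. eexists. now apply Hg.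
- intros z Hz. rewrite HF by assumption. unfold almansi_term.
  apply (is_series_sum_n_m (K := C_AbsRing) (V := C_NormedModule)
    (fun n j => RtoC (Cmod z ^ (2 * (n - 1)))
       * (a n (S j) * z ^ S j + Cconj (b n (S j) * z ^ S j)))%C).
  intros n Hn.
  apply (is_series_scal (K := C_AbsRing) (V := C_NormedModule)).
  apply (is_series_plus (K := C_AbsRing) (V := C_NormedModule)
    (fun j => a n (S j) * z ^ S j)%C (fun j => Cconj (b n (S j) * z ^ S j))).
  + now apply Hh.
  + apply is_series_Cconj. now apply Hg.
Qed.

(** The Fourier coefficients of F on the circle of radius r are the radial
    coefficients of [a] at positive and the conjugates of those of [b] at negative
    frequencies. *)
Definition radial_coefficient (p : nat) (a : nat -> nat -> C) (r : R) (j : nat) : C :=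
  sum_n_m (G := C_AbelianMonoid) (fun n => a n j * RtoC (r ^ (2 * (n - 1) + j)))%C 1 p.

Lemma sum_n_m_ext_C (f g : nat -> C) (m n : nat) :
  (forall k, (m <= k <= n)%nat -> f k = g k) ->
  sum_n_m (G := C_AbelianMonoid) f m n = sum_n_m (G := C_AbelianMonoid) g m n.
Proof. intros H. now apply sum_n_m_ext_loc. Qed.

Lemma almansi_term_polar (p : nat) (a b : nat -> nat -> C) (j : nat) (r t : R) :
  0 <= r ->
  almansi_term p a b j (RtoC r * cis t)%C
  = (radial_coefficient p a r j * cis (INR j * t)
     + Cconj (radial_coefficient p b r j) * cis (- (INR j * t)))%C.
Proof.
intros Hr. unfold almansi_term, radial_coefficient.
rewrite (sum_n_m_additive (G := C_AbelianMonoid) (H := C_AbelianMonoid)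
  (fun x => x * cis (INR j * t))%C).
2: { apply Cmult_0_l. }
2: { intros x y. apply Cmult_plus_distr_r. }
rewrite (sum_n_m_additive (G := C_AbelianMonoid) (H := C_AbelianMonoid)
  (fun x => Cconj x * cis (- (INR j * t)))%C).
2: { unfold zero; simpl. apply injective_projections; simpl; ring. }
2: { intros x y. unfold plus; simpl. rewrite Cplus_conj. apply Cmult_plus_distr_r. }
rewrite <- (sum_n_m_plus (G := C_AbelianMonoid)).
apply sum_n_m_ext_C. intros n _.
match goal with |- _ = plus ?x ?y => change (plus x y) with (Cplus x y) end.
rewrite Cmod_polar by assumption.
rewrite Cpow_mult_l, cis_pow, pow_add, RtoC_mult, <- (RtoC_pow r j).
rewrite cis_neg, !Cmult_conj.
assert (E : forall x : R, Cconj (RtoC x) = RtoC x)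
  by (intros x; unfold Cconj, RtoC; simpl; now rewrite Ropp_0).
rewrite !E. Cring.
Qed.

Lemma Cmod_radial_coefficient_le (p : nat) (a : nat -> nat -> C) (r : R) (j : nat) :
  0 <= r <= 1 ->
  Cmod (radial_coefficient p a r j)
  <= sum_n_m (G := R_AbelianMonoid) (fun n => Cmod (a n j) * r ^ j) 1 p.
Proof.
intros Hr. unfold radial_coefficient.
eapply Rle_trans; [apply Cmod_sum_n_m_le|].
apply sum_n_m_le_range. intros n _.
rewrite Cmod_mult, Cmod_R, Rabs_pos_eq by (apply pow_le; lra).
apply Rmult_le_compat_l; [apply Cmod_ge_0|].
rewrite pow_add. rewrite <- (Rmult_1_l (r ^ j)) at 2.
apply Rmult_le_compat_r; [apply pow_le; lra|].
rewrite <- (pow1 (2 * (n - 1))). apply pow_incr. lra.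
Qed.

Lemma radial_coefficient_summable (p : nat) (a : nat -> nat -> C) (r : R) :
  (forall n, (1 <= n <= p)%nat -> forall z : C, disk 1 z ->
     ex_series (K := C_AbsRing) (V := C_NormedModule) (fun j => a n (S j) * z ^ S j)%C) ->
  0 <= r < 1 -> ex_series (fun k => Cmod (radial_coefficient p a r (S k))).
Proof.
intros Ha Hr.
apply (ex_series_le (K := R_AbsRing) (V := R_CompleteNormedModule) _
  (fun k => sum_n_m (G := R_AbelianMonoid) (fun n => Cmod (a n (S k)) * r ^ S k) 1 p)).
- intros k. change (Rabs (Cmod (radial_coefficient p a r (S k)))
    <= sum_n_m (G := R_AbelianMonoid) (fun n => Cmod (a n (S k)) * r ^ S k) 1 p).
  rewrite Rabs_pos_eq by apply Cmod_ge_0.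
  apply Cmod_radial_coefficient_le. lra.
- eexists. apply (is_series_sum_n_m (K := R_AbsRing) (V := R_NormedModule)
    (fun n k => Cmod (a n (S k)) * r ^ S k)
    (fun n => Series (fun k => Cmod (a n (S k)) * r ^ S k))).
  intros n Hn. apply Series_correct.
  apply power_series_abs_summable; [exact Hr|]. now apply Ha.
Qed.

(** Principal argument 0 means that the quotients are positive, so a single
    rotation makes all the numbers nonnegative. *)
Lemma common_rotation (p : nat) (x : nat -> C) :
  (forall n1 n2, (1 <= n1 <= p)%nat -> (1 <= n2 <= p)%nat ->
     x n1 <> RtoC 0 -> x n2 <> RtoC 0 -> Rabs (Carg (x n1 / x n2)%C) = 0) ->
  exists u : C, Cmod u = 1 /\
    forall n, (1 <= n <= p)%nat -> (u * x n)%C = RtoC (Cmod (x n)).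
Proof.
intros Hx.
destruct (classic (exists m, (1 <= m <= p)%nat /\ x m <> RtoC 0)) as [[m [Hm Hxm]]|Hno].
- assert (Hpos : 0 < Cmod (x m)) by now apply Cmod_gt_0.
  assert (Hr : RtoC (Cmod (x m)) <> RtoC 0) by (intros E; injection E; lra).
  exists (RtoC (Cmod (x m)) / x m)%C. split.
  + rewrite Cmod_div, Cmod_R, Rabs_pos_eq by (assumption || lra). field. lra.
  + intros n Hn. destruct (classic (x n = RtoC 0)) as [E|Hxn].
    * rewrite E, Cmod_0. apply Cmult_0_r.
    * specialize (Hx n m Hn Hm Hxn Hxm).
      assert (Hq : (x n / x m)%C <> RtoC 0).
      { intros E. apply Hxn. replace (x n) with (x n / x m * x m)%C by (field; assumption).
        rewrite E. apply Cmult_0_l. }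
      destruct (Carg_spec _ Hq) as [_ Hs].
      assert (E : Carg (x n / x m)%C = 0).
      { destruct (Req_dec (Carg (x n / x m)%C) 0) as [E|E]; [exact E|].
        now apply Rabs_no_R0 in E. }
      rewrite E, cis_0, Cmult_1_r, Cmod_div in Hs by assumption.
      replace (Cmod (x m) / x m * x n)%C with (Cmod (x m) * (x n / x m))%C
        by (field; assumption).
      rewrite Hs. rewrite <- RtoC_mult. f_equal. field. lra.
- exists (RtoC 1). split; [apply Cmod_1|].
  intros n Hn. destruct (classic (x n = RtoC 0)) as [E|Hxn].
  + rewrite E, Cmod_0. apply Cmult_0_r.
  + exfalso. apply Hno. now exists n.
Qed.

Lemma rotated_radial_coefficient (p : nat) (a : nat -> nat -> C) (u : C) (r : R) (j : nat) :
  (forall n, (1 <= n <= p)%nat -> (u * a n j)%C = RtoC (Cmod (a n j))) ->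
  (u * radial_coefficient p a r j)%C
  = RtoC (sum_n_m (G := R_AbelianMonoid)
            (fun n => Cmod (a n j) * r ^ (2 * (n - 1) + j)) 1 p).
Proof.
intros Hu. unfold radial_coefficient.
rewrite (sum_n_m_additive (G := C_AbelianMonoid) (H := C_AbelianMonoid) (fun x => u * x)%C).
2: { apply Cmult_0_r. }
2: { intros x y. apply Cmult_plus_distr_l. }
rewrite (sum_n_m_additive (G := R_AbelianMonoid) (H := C_AbelianMonoid) RtoC).
2: { reflexivity. }
2: { intros x y. apply RtoC_plus. }
apply sum_n_m_ext_C. intros n Hn.
rewrite Cmult_assoc, Hu, <- RtoC_mult by assumption. reflexivity.
Qed.

(** The hypotheses on [u] and [v] exclude any cancellation between the layers. *)
Lemma moment_almansi (p k : nat) (a b : nat -> nat -> C) (F : C -> C) (u v : C)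
    (j : nat) (r : R) :
  almansi_expansion p a b F -> (1 <= k)%nat -> Ck_on k (disk 1) F -> (1 <= j)%nat ->
  (forall n, (1 <= n <= p)%nat -> (u * a n j)%C = RtoC (Cmod (a n j))) ->
  (forall n, (1 <= n <= p)%nat -> (v * b n j)%C = RtoC (Cmod (b n j))) ->
  0 <= r < 1 ->
  moment u v j F r
  = 2 * PI * sum_n_m (G := R_AbelianMonoid)
      (fun n => (Cmod (a n j) + Cmod (b n j)) * r ^ (2 * (n - 1) + j)) 1 p.
Proof.
intros [Ha [Hb HF]] Hk HC Hj Hu Hv Hr.
destruct (Ck_on_C1_on_disk k F Hk HC) as [HU HV].
assert (Hr' : -1 < r < 1) by lra.
assert (I1 : is_RInt (fun t => Re (multiplier u v j t * F (RtoC r * cis t))%C) 0 (2 * PI)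
  (moment u v j F r)).
{ apply is_RInt_ext with (fun t => minus
    (((Re u + Re v) * cos (INR j * t) + (Im u + Im v) * sin (INR j * t))
       * Re (F (r * cos t, r * sin t)))
    (((Im u - Im v) * cos (INR j * t) + (Re v - Re u) * sin (INR j * t))
       * Im (F (r * cos t, r * sin t)))).
  - intros t _. rewrite polar_point.
    destruct (F (r * cos t, r * sin t)) as [x y].
    destruct u as [u1 u2], v as [v1 v2].
    unfold multiplier, minus, plus, opp, cis, Re, Im; simpl.
    rewrite cos_neg, sin_neg. ring.
  - apply (is_RInt_minus (V := R_NormedModule));
      apply (RInt_correct (V := R_CompleteNormedModule));
      apply (ex_RInt_continuous (V := R_CompleteNormedModule)); intros t _;
      (apply (continuous_mult (K := R_AbsRing)); [apply continuous_trig|]).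
    + now apply (continuous_on_circle _ _ _ r t HU).
    + now apply (continuous_on_circle _ _ _ r t HV). }
assert (I2 := is_RInt_multiplier_series u v j
  (fun k => radial_coefficient p a r k) (fun k => Cconj (radial_coefficient p b r k))
  (fun t => F (RtoC r * cis t)%C) Hj).
apply (is_RInt_unique (V := R_CompleteNormedModule)) in I1.
rewrite <- I1.
etransitivity; [apply (is_RInt_unique (V := R_CompleteNormedModule)), I2|]; clear I1 I2.
- intros t. apply is_series_ext with (fun k => almansi_term p a b (S k) (RtoC r * cis t)%C).
  + intros i. apply almansi_term_polar. lra.
  + apply HF. now apply disk_polar.
- apply (ex_series_plus (K := R_AbsRing) (V := R_NormedModule)).
  + now apply radial_coefficient_summable.
  + apply ex_series_ext with (fun k => Cmod (radial_coefficient p b r (S k))).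
    * intros i. now rewrite Cmod_conj.
    * now apply radial_coefficient_summable.
- f_equal. rewrite rotated_radial_coefficient by assumption.
  rewrite <- Cmult_conj, rotated_radial_coefficient by assumption.
  simpl. rewrite <- (sum_n_m_plus (G := R_AbelianMonoid)).
  apply sum_n_m_ext_loc. intros n _. unfold plus; simpl. ring.
Qed.

Lemma is_derive_sum_pow (c : nat -> R) (e : nat -> nat) (m n : nat) (r : R) :
  is_derive (fun s => sum_n_m (G := R_AbelianMonoid) (fun k => c k * s ^ e k) m n) r
    (sum_n_m (G := R_AbelianMonoid) (fun k => c k * (INR (e k) * r ^ pred (e k))) m n).
Proof.
assert (H1 : forall k, is_derive (fun s => c k * s ^ e k) r (c k * (INR (e k) * r ^ pred (e k)))).
{ intros k. auto_derive; [trivial|ring]. }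
assert (H0 : forall m n, (n < m)%nat -> is_derive
  (fun s => sum_n_m (G := R_AbelianMonoid) (fun k => c k * s ^ e k) m n) r
    (sum_n_m (G := R_AbelianMonoid) (fun k => c k * (INR (e k) * r ^ pred (e k))) m n)).
{ intros m' n' Hlt. rewrite sum_n_m_zero by assumption.
  apply is_derive_ext with (fun _ => zero : R).
  - intros s. now rewrite sum_n_m_zero.
  - apply (is_derive_const (K := R_AbsRing) (V := R_NormedModule)). }
induction n as [|n IH].
- destruct m as [|m].
  + rewrite sum_n_n. apply is_derive_ext with (fun s => c 0%nat * s ^ e 0%nat); [|apply H1].
    intros s. now rewrite sum_n_n.
  + apply H0. lia.
- destruct (Nat.le_gt_cases m (S n)) as [Hm|Hm]; [|now apply H0].
  rewrite sum_n_Sm by lia.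
  apply is_derive_ext with (fun s => plus
    (sum_n_m (G := R_AbelianMonoid) (fun k => c k * s ^ e k) m n) (c (S n) * s ^ e (S n))).
  + intros s. now rewrite sum_n_Sm by lia.
  + apply (is_derive_plus (K := R_AbsRing) (V := R_NormedModule)); [apply IH|apply H1].
Qed.

Lemma le_of_mul_pow_le (x y : R) (m : nat) :
  (forall r, 0 < r < 1 -> x * r ^ m <= y) -> x <= y.
Proof.
intros H. apply Rnot_lt_le. intros Hlt.
assert (Hc : continuity_pt (fun r => x * r ^ m) 1).
{ apply derivable_continuous_pt. exists (x * (INR m * 1 ^ pred m)).
  apply is_derive_Reals. auto_derive; [trivial|ring]. }
destruct (Hc (x - y)) as [d [Hd HH]]; [lra|].
set (r := 1 - Rmin d 1 / 2).
assert (Hm : 0 < Rmin d 1 <= 1) by (split; [apply Rmin_pos; lra|apply Rmin_r]).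
assert (Hm2 : Rmin d 1 <= d) by apply Rmin_l.
specialize (HH r). specialize (H r ltac:(unfold r; lra)).
assert (Hdist : Rabs (x * r ^ m - x * 1 ^ m) < x - y).
{ apply HH. split.
  - split; [exact I|unfold r; lra].
  - simpl. unfold Rdist, r. rewrite Rabs_left; lra. }
rewrite pow1 in Hdist. apply Rabs_def2 in Hdist. lra.
Qed.

(** With c the moduli and e = 2 (n - 1) + j the exponents in [moment_almansi],
    r Q' + j Q has the terms 2 PI (e + j) c r^e = 4 PI (n - 1 + j) c r^e. They are
    nonnegative, so each of them is bounded by 2 K L. *)
Lemma coefficient_bound (p k : nat) (a b : nat -> nat -> C) (F : C -> C) (K L : R) :
  almansi_expansion p a b F -> (1 <= k)%nat -> Ck_on k (disk 1) F ->
  quasiregular K F -> 0 <= K ->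
  (forall r, 0 < r < 1 -> circle_length F r <= L) ->
  (forall j n1 n2 : nat, (1 <= j)%nat -> (1 <= n1 <= p)%nat -> (1 <= n2 <= p)%nat ->
     a n1 j <> RtoC 0 -> a n2 j <> RtoC 0 -> Rabs (Carg (a n1 j / a n2 j)%C) = 0) ->
  (forall j n1 n2 : nat, (1 <= j)%nat -> (1 <= n1 <= p)%nat -> (1 <= n2 <= p)%nat ->
     b n1 j <> RtoC 0 -> b n2 j <> RtoC 0 -> Rabs (Carg (b n1 j / b n2 j)%C) = 0) ->
  forall n j, (1 <= n <= p)%nat -> (1 <= j)%nat ->
    INR (n - 1 + j) * (Cmod (a n j) + Cmod (b n j)) <= K * L / (2 * PI).
Proof.
intros HF Hk HC Hq HK HL Ha Hb n j Hn Hj.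
pose proof PI_RGT_0 as HPI.
destruct (common_rotation p (fun n => a n j)) as [u [Hu1 Hu]]; [intros; now apply Ha|].
destruct (common_rotation p (fun n => b n j)) as [v [Hv1 Hv]]; [intros; now apply Hb|].
set (c := fun n => Cmod (a n j) + Cmod (b n j)).
assert (Hc0 : forall n, 0 <= c n)
  by (intros i; unfold c; pose proof (Cmod_ge_0 (a i j)); pose proof (Cmod_ge_0 (b i j)); lra).
apply (le_of_mul_pow_le _ _ (2 * (n - 1) + j)). intros r Hr.
destruct (moment_derivative_le u v j k K F r Hk HC Hq HK Hu1 Hv1 Hr) as [d [Hd Hle]].
assert (Hd' : is_derive (moment u v j F) r (2 * PI * sum_n_m (G := R_AbelianMonoid)
   (fun i => c i * (INR (2 * (i - 1) + j) * r ^ pred (2 * (i - 1) + j))) 1 p)).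
{ apply is_derive_ext_loc with (fun s => 2 * PI * sum_n_m (G := R_AbelianMonoid)
    (fun i => c i * s ^ (2 * (i - 1) + j)) 1 p).
  - assert (Hloc : locally r (fun s => 0 < s < 1)).
    { apply (filter_and (fun s => 0 < s) (fun s => s < 1)).
      - apply open_gt. lra.
      - apply open_lt. lra. }
    revert Hloc. apply filter_imp. intros s Hs. symmetry.
    apply moment_almansi with k; try assumption. lra.
  - apply (is_derive_scal (fun s => sum_n_m (G := R_AbelianMonoid) (fun i => c i * s ^ (2 * (i - 1) + j)) 1 p)).
    apply (is_derive_sum_pow c (fun i => 2 * (i - 1) + j)%nat). }
assert (E : d = 2 * PI * sum_n_m (G := R_AbelianMonoid)
   (fun i => c i * (INR (2 * (i - 1) + j) * r ^ pred (2 * (i - 1) + j))) 1 p)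
  by (apply is_derive_unique in Hd; apply is_derive_unique in Hd'; congruence).
rewrite (moment_almansi p k a b F u v j r HF Hk HC Hj Hu Hv ltac:(lra)) in Hle.
assert (E2 : r * d + INR j * (2 * PI * sum_n_m (G := R_AbelianMonoid)
    (fun i => c i * r ^ (2 * (i - 1) + j)) 1 p)
  = 4 * PI * sum_n_m (G := R_AbelianMonoid)
     (fun i => INR (i - 1 + j) * c i * r ^ (2 * (i - 1) + j)) 1 p).
{ rewrite E.
  assert (Hlin : forall (x : R) (f : nat -> R), x * sum_n_m (G := R_AbelianMonoid) f 1 p
     = sum_n_m (G := R_AbelianMonoid) (fun i => x * f i) 1 p).
  { intros x f. symmetry. apply (sum_n_m_mult_l (K := R_AbsRing) x f). }
  rewrite <- !Rmult_assoc, !Hlin.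
  rewrite <- (sum_n_m_plus (G := R_AbelianMonoid)).
  apply sum_n_m_ext_loc. intros i _. unfold plus; simpl AbelianMonoid.plus.
  change (r * 2 * PI * (c i * (INR (2 * (i - 1) + j) * r ^ pred (2 * (i - 1) + j))) +
    INR j * 2 * PI * (c i * r ^ (2 * (i - 1) + j)) =
    4 * PI * (INR (i - 1 + j) * c i * r ^ (2 * (i - 1) + j))).
  destruct (2 * (i - 1) + j)%nat as [|q] eqn:Eq; [lia|].
  assert (Er : INR (S q) = 2 * INR (i - 1 + j) - INR j).
  { rewrite <- Eq, !plus_INR, mult_INR. simpl. ring. }
  rewrite Er. simpl pred. rewrite <- tech_pow_Rmult. ring. }
assert (Hle2 : 4 * PI * sum_n_m (G := R_AbelianMonoid)
     (fun i => INR (i - 1 + j) * c i * r ^ (2 * (i - 1) + j)) 1 p <= 2 * K * L).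
{ rewrite <- E2. eapply Rle_trans; [exact Hle|].
  apply Rmult_le_compat_l; [lra|]. now apply HL. }
assert (Ht := term_le_sum_n_m (fun i => INR (i - 1 + j) * c i * r ^ (2 * (i - 1) + j)) 1 p n).
simpl in Ht.
apply Rmult_le_reg_l with (4 * PI); [lra|].
replace (4 * PI * (K * L / (2 * PI))) with (2 * K * L) by (field; lra).
eapply Rle_trans; [|exact Hle2].
apply Rmult_le_compat_l; [lra|]. apply Ht; [|exact Hn].
intros i _. apply Rmult_le_pos; [apply Rmult_le_pos; [apply pos_INR|apply Hc0]|].
apply pow_le. lra.
Qed.

(** * The remainder after the linear part *)

Definition higher_radial_sum (p : nat) (r : R) : R :=
  sum_n_m (G := R_AbelianMonoid) (fun n => r ^ (2 * (n - 1))) 2 p.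

Definition linear_part (a b : nat -> nat -> C) (z : C) : C :=
  (a 1%nat 1%nat * z + Cconj (b 1%nat 1%nat * z))%C.

Definition remainder (a b : nat -> nat -> C) (F : C -> C) (z : C) : C :=
  (F z - linear_part a b z)%C.

Lemma Cpow_lipschitz (r : R) (z w : C) (e : nat) :
  Cmod z <= r -> Cmod w <= r ->
  Cmod (z ^ e - w ^ e)%C <= INR e * r ^ pred e * Cmod (z - w)%C.
Proof.
intros Hz Hw. assert (Hr : 0 <= r) by (eapply Rle_trans; [apply Cmod_ge_0|exact Hz]).
induction e as [|e IH].
- simpl. replace (1 - 1)%C with (RtoC 0) by ring. rewrite Cmod_0. lra.
- replace (z ^ S e - w ^ S e)%C with (z * (z ^ e - w ^ e) + (z - w) * w ^ e)%C
    by (rewrite !Cpow_S; ring).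
  eapply Rle_trans; [apply Cmod_triangle|]. rewrite !Cmod_mult, Cmod_pow.
  assert (H1 : Cmod z * Cmod (z ^ e - w ^ e)%C <= INR e * r ^ e * Cmod (z - w)%C).
  { apply Rle_trans with (r * (INR e * r ^ pred e * Cmod (z - w)%C)).
    - apply Rmult_le_compat; try apply Cmod_ge_0; assumption.
    - apply Req_le. destruct e as [|e]; [simpl; ring|].
      rewrite <- (tech_pow_Rmult r e). simpl pred. ring. }
  assert (H2 : Cmod (z - w)%C * Cmod w ^ e <= Cmod (z - w)%C * r ^ e).
  { apply Rmult_le_compat_l; [apply Cmod_ge_0|]. apply pow_incr.
    split; [apply Cmod_ge_0|assumption]. }
  rewrite S_INR. simpl pred. lra.
Qed.

Lemma Cmod_lipschitz (z w : C) : Cmod (RtoC (Cmod z) - RtoC (Cmod w))%C <= Cmod (z - w)%C.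
Proof.
rewrite <- RtoC_minus, Cmod_R. apply Rabs_le. split.
- assert (Cmod w <= Cmod z + Cmod (z - w)%C); [|lra].
  rewrite <- (Cmod_opp (z - w)%C).
  replace w with (z + - (z - w))%C at 1 by ring. apply Cmod_triangle.
- assert (Cmod z <= Cmod w + Cmod (z - w)%C); [|lra].
  replace z with (w + (z - w))%C at 1 by ring. apply Cmod_triangle.
Qed.

(** The monomial is homogeneous of degree e + j, and its Lipschitz constant is that
    of a power of this degree. *)
Lemma radial_monomial_lipschitz (r : R) (z w : C) (e j : nat) :
  Cmod z <= r -> Cmod w <= r ->
  Cmod (RtoC (Cmod z ^ e) * z ^ j - RtoC (Cmod w ^ e) * w ^ j)%C
  <= INR (e + j) * r ^ pred (e + j) * Cmod (z - w)%C.
Proof.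
intros Hz Hw. assert (Hr : 0 <= r) by (eapply Rle_trans; [apply Cmod_ge_0|exact Hz]).
rewrite !RtoC_pow.
replace (_ - _)%C with ((RtoC (Cmod z) ^ e - RtoC (Cmod w) ^ e) * z ^ j
  + RtoC (Cmod w) ^ e * (z ^ j - w ^ j))%C by ring.
eapply Rle_trans; [apply Cmod_triangle|]. rewrite !Cmod_mult, !Cmod_pow.
assert (HR : forall x : C, Cmod (RtoC (Cmod x)) = Cmod x)
  by (intros x; rewrite Cmod_R; apply Rabs_pos_eq, Cmod_ge_0).
rewrite HR.
assert (H1 : Cmod (RtoC (Cmod z) ^ e - RtoC (Cmod w) ^ e)%C * Cmod z ^ j
  <= INR e * r ^ pred (e + j) * Cmod (z - w)%C).
{ apply Rle_trans with ((INR e * r ^ pred e * Cmod (z - w)%C) * r ^ j).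
  - apply Rmult_le_compat; [apply Cmod_ge_0|apply pow_le, Cmod_ge_0| |].
    + eapply Rle_trans.
      * apply (Cpow_lipschitz r); rewrite HR; assumption.
      * apply Rmult_le_compat_l; [|apply Cmod_lipschitz].
        apply Rmult_le_pos; [apply pos_INR|apply pow_le; assumption].
    + apply pow_incr. split; [apply Cmod_ge_0|assumption].
  - apply Req_le. destruct e as [|e]; [simpl; ring|].
    simpl pred. rewrite pow_add. ring. }
assert (H2 : Cmod w ^ e * Cmod (z ^ j - w ^ j)%C
  <= INR j * r ^ pred (e + j) * Cmod (z - w)%C).
{ apply Rle_trans with (r ^ e * (INR j * r ^ pred j * Cmod (z - w)%C)).
  - apply Rmult_le_compat; [apply pow_le, Cmod_ge_0|apply Cmod_ge_0| |].
    + apply pow_incr. split; [apply Cmod_ge_0|assumption].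
    + now apply Cpow_lipschitz.
  - apply Req_le. destruct j as [|j]; [simpl; ring|].
    rewrite Nat.add_succ_r. simpl pred. rewrite pow_add. ring. }
rewrite plus_INR. lra.
Qed.

Lemma Cmod_linear_part_le (x y z w : C) :
  Cmod ((x * z + Cconj (y * z)) - (x * w + Cconj (y * w)))%C
  <= (Cmod x + Cmod y) * Cmod (z - w)%C.
Proof.
replace (_ - _)%C with (x * (z - w) + Cconj (y * (z - w)))%C.
- eapply Rle_trans; [apply Cmod_triangle|].
  rewrite Cmod_conj, !Cmod_mult. lra.
- rewrite !Cmult_conj, Cminus_conj. ring.
Qed.

(** The layer n = 1 contributes from degree 2 on: its term of degree 1, at k = 0, is
    the linear part. The index is k = j - 1. *)
Definition remainder_term (p : nat) (a b : nat -> nat -> C) (k : nat) (z : C) : C :=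
  ((if k then 0 else a 1%nat (S k) * z ^ S k + Cconj (b 1%nat (S k) * z ^ S k))
   + sum_n_m (G := C_AbelianMonoid)
       (fun n => RtoC (Cmod z ^ (2 * (n - 1)))
          * (a n (S k) * z ^ S k + Cconj (b n (S k) * z ^ S k))) 2 p)%C.

Lemma is_series_remainder (p : nat) (a b : nat -> nat -> C) (F : C -> C) (z : C) :
  (1 <= p)%nat -> almansi_expansion p a b F -> disk 1 z ->
  is_series (K := C_AbsRing) (V := C_NormedModule)
    (fun k => remainder_term p a b k z) (remainder a b F z).
Proof.
intros Hp [_ [_ HF]] Hz.
set (x := linear_part a b z).
assert (Hx : is_series (K := C_AbsRing) (V := C_NormedModule)
  (fun k : nat => if k then (- x)%C else RtoC 0) (- x)%C).
{ apply is_series_Cmod_converges. intros eps He. exists 0%nat. intros n _.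
  replace (sum_n _ n) with (- x : C)%C.
  - replace (- x - - x)%C with (RtoC 0) by ring. now rewrite Cmod_0.
  - induction n as [|n IH]; [now rewrite sum_O|].
    rewrite sum_Sn, <- IH. symmetry. apply Cplus_0_r. }
apply is_series_ext with (fun k => plus (almansi_term p a b (S k) z : C_NormedModule)
  (if k then (- x)%C else RtoC 0)).
- intros k. unfold almansi_term, remainder_term.
  rewrite sum_Sn_m by assumption.
  match goal with |- context [sum_n_m ?f 2 p] => set (s := sum_n_m f 2 p : C) end.
  change (sum_n_m (G := C_AbelianMonoid) (fun n => RtoC (Cmod z ^ (2 * (n - 1)))
    * (a n (S k) * z ^ S k + Cconj (b n (S k) * z ^ S k)))%C 2 p) with s.
  match goal with |- plus (plus ?y _) ?d = _ => change ((y + s + d)%C =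
    ((if k then 0 else a 1%nat (S k) * z ^ S k + Cconj (b 1%nat (S k) * z ^ S k)) + s)%C) end.
  change (Cmod z ^ (2 * (1 - 1))) with 1.
  destruct k as [|k].
  + unfold x, linear_part. rewrite Cpow_1_r. ring.
  + ring.
- apply (is_series_plus (K := C_AbsRing) (V := C_NormedModule)).
  + now apply HF.
  + exact Hx.
Qed.

Definition coefficient_decay (p : nat) (a b : nat -> nat -> C) (M : R) : Prop :=
  forall n j, (1 <= n <= p)%nat -> (1 <= j)%nat ->
    INR (n - 1 + j) * (Cmod (a n j) + Cmod (b n j)) <= M.

Lemma higher_radial_sum_scal (p : nat) (r x : R) :
  sum_n_m (G := R_AbelianMonoid) (fun n => x * r ^ (2 * (n - 1))) 2 p
  = x * higher_radial_sum p r.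
Proof.
apply (sum_n_m_mult_l (K := R_AbsRing) x (fun n => r ^ (2 * (n - 1)))).
Qed.

Lemma higher_radial_sum_nonneg (p : nat) (r : R) : 0 <= r -> 0 <= higher_radial_sum p r.
Proof. intros Hr. apply sum_n_m_nonneg. intros n _. now apply pow_le. Qed.

(** The Lipschitz constant of the monomials of layer n is a multiple of their degree
    2 (n - 1) + j, which is j for n = 1 and at most 2 (n - 1 + j) otherwise; the decay
    of the coefficients absorbs it. *)
Lemma remainder_term_lipschitz (p : nat) (a b : nat -> nat -> C) (M r : R) (k : nat) (z w : C) :
  (1 <= p)%nat -> coefficient_decay p a b M ->
  Cmod z <= r -> Cmod w <= r ->
  Cmod (remainder_term p a b k z - remainder_term p a b k w)%C
  <= M * Cmod (z - w)%C * ((if k then 0 else r ^ k) + 2 * higher_radial_sum p r * r ^ k).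
Proof.
intros Hp HM Hz Hw. assert (Hr : 0 <= r) by (eapply Rle_trans; [apply Cmod_ge_0|exact Hz]).
set (D := Cmod (z - w)%C). assert (HD : 0 <= D) by apply Cmod_ge_0.
assert (HM0 : 0 <= M).
{ eapply Rle_trans; [|apply (HM 1%nat 1%nat); lia].
  pose proof (Cmod_ge_0 (a 1%nat 1%nat)); pose proof (Cmod_ge_0 (b 1%nat 1%nat)).
  simpl. lra. }
set (tm := fun n (x : C) => (RtoC (Cmod x ^ (2 * (n - 1)))
          * (a n (S k) * x ^ S k + Cconj (b n (S k) * x ^ S k)))%C).
assert (Ht : forall n, (1 <= n <= p)%nat -> Cmod (tm n z - tm n w)%C
  <= (Cmod (a n (S k)) + Cmod (b n (S k))) *
     (INR (2 * (n - 1) + S k) * r ^ pred (2 * (n - 1) + S k) * D)).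
{ intros n Hn. unfold tm.
  assert (E : forall x : C, (RtoC (Cmod x ^ (2 * (n - 1)))
     * (a n (S k) * x ^ S k + Cconj (b n (S k) * x ^ S k)))%C
    = (a n (S k) * (RtoC (Cmod x ^ (2 * (n - 1))) * x ^ S k)
       + Cconj (b n (S k) * (RtoC (Cmod x ^ (2 * (n - 1))) * x ^ S k)))%C).
  { intros x. rewrite !Cmult_conj.
    replace (Cconj (RtoC (Cmod x ^ (2 * (n - 1))))) with (RtoC (Cmod x ^ (2 * (n - 1)))).
    - ring.
    - unfold Cconj, RtoC; simpl fst; simpl snd. now rewrite Ropp_0. }
  rewrite !E. eapply Rle_trans; [apply Cmod_linear_part_le|].
  apply Rmult_le_compat_l.
  - pose proof (Cmod_ge_0 (a n (S k))); pose proof (Cmod_ge_0 (b n (S k))). lra.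
  - now apply radial_monomial_lipschitz. }
assert (Hsum : Cmod (sum_n_m (G := C_AbelianMonoid) (fun n => tm n z) 2 p
    - sum_n_m (G := C_AbelianMonoid) (fun n => tm n w) 2 p)%C
  <= M * D * (2 * higher_radial_sum p r * r ^ k)).
{ replace (_ - _)%C with (sum_n_m (G := C_AbelianMonoid) (fun n => tm n z - tm n w)%C 2 p).
  - eapply Rle_trans; [apply Cmod_sum_n_m_le|].
    replace (M * D * (2 * higher_radial_sum p r * r ^ k))
      with ((2 * M * D * r ^ k) * higher_radial_sum p r) by ring.
    rewrite <- higher_radial_sum_scal.
    apply sum_n_m_le_range. intros n Hn.
    eapply Rle_trans; [apply Ht; lia|].
    replace (pred (2 * (n - 1) + S k)) with (2 * (n - 1) + k)%nat by lia.
    rewrite pow_add.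
    replace (_ * (_ * _ * D)) with
      (INR (2 * (n - 1) + S k) * (Cmod (a n (S k)) + Cmod (b n (S k)))
        * (r ^ (2 * (n - 1)) * r ^ k * D)) by ring.
    replace (2 * M * D * r ^ k * r ^ (2 * (n - 1)))
      with (2 * M * (r ^ (2 * (n - 1)) * r ^ k * D)) by ring.
    apply Rmult_le_compat_r.
    + apply Rmult_le_pos; [|exact HD]. apply Rmult_le_pos; now apply pow_le.
    + assert (Hc := HM n (S k) ltac:(lia) ltac:(lia)).
      assert (Hc0 : 0 <= Cmod (a n (S k)) + Cmod (b n (S k))).
      { pose proof (Cmod_ge_0 (a n (S k))); pose proof (Cmod_ge_0 (b n (S k))). lra. }
      assert (Hi : INR (2 * (n - 1) + S k) <= 2 * INR (n - 1 + S k)).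
      { change 2 with (INR 2). rewrite <- mult_INR. apply le_INR. lia. }
      apply Rle_trans with (2 * INR (n - 1 + S k) * (Cmod (a n (S k)) + Cmod (b n (S k)))).
      * now apply Rmult_le_compat_r.
      * lra.
  - rewrite (sum_n_m_ext_C _ (fun n => plus (tm n z) (opp (tm n w) : C))).
    + rewrite (sum_n_m_plus (G := C_AbelianMonoid)).
      rewrite <- (sum_n_m_additive (G := C_AbelianMonoid) (H := C_AbelianMonoid) Copp
        (fun n => tm n w)).
      * reflexivity.
      * apply injective_projections; simpl; ring.
      * intros x y. apply injective_projections; simpl; ring.
    + intros n _. reflexivity. }
unfold remainder_term.
change (fun n => RtoC (Cmod z ^ (2 * (n - 1)))
          * (a n (S k) * z ^ S k + Cconj (b n (S k) * z ^ S k)))%C with (fun n => tm n z).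
change (fun n => RtoC (Cmod w ^ (2 * (n - 1)))
          * (a n (S k) * w ^ S k + Cconj (b n (S k) * w ^ S k)))%C with (fun n => tm n w).
set (sz := sum_n_m (G := C_AbelianMonoid) (fun n => tm n z) 2 p : C) in *.
set (sw := sum_n_m (G := C_AbelianMonoid) (fun n => tm n w) 2 p : C) in *.
destruct k as [|k].
- replace (0 + sz - (0 + sw))%C with (sz - sw)%C by ring. lra.
- replace (_ - _)%C with ((tm 1%nat z - tm 1%nat w) + (sz - sw))%C.
  + eapply Rle_trans; [apply Cmod_triangle|].
    rewrite Rmult_plus_distr_l. apply Rplus_le_compat; [|exact Hsum].
    eapply Rle_trans; [apply Ht; lia|].
    assert (Hc := HM 1%nat (S (S k)) ltac:(lia) ltac:(lia)).
    change (1 - 1 + S (S k))%nat with (S (S k)) in Hc.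
    change (2 * (1 - 1) + S (S k))%nat with (S (S k)). simpl pred.
    replace (_ * (_ * _ * D)) with
      (INR (S (S k)) * (Cmod (a 1%nat (S (S k))) + Cmod (b 1%nat (S (S k))))
        * (r ^ S k * D)) by ring.
    replace (M * D * r ^ S k) with (M * (r ^ S k * D)) by ring.
    apply Rmult_le_compat_r; [|exact Hc].
    apply Rmult_le_pos; [now apply pow_le|exact HD].
  + unfold tm. change (Cmod z ^ (2 * (1 - 1))) with 1. change (Cmod w ^ (2 * (1 - 1))) with 1. ring.
Qed.

(** The sum over k of the bounds in [remainder_term_lipschitz], per unit of
    distance. *)
Definition lipschitz_bound (p : nat) (M r : R) : R :=
  M * (r + 2 * higher_radial_sum p r) / (1 - r).

Lemma remainder_lipschitz (p : nat) (a b : nat -> nat -> C) (F : C -> C) (M r : R) (z w : C) :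
  (1 <= p)%nat -> almansi_expansion p a b F -> coefficient_decay p a b M ->
  0 <= M -> r < 1 -> Cmod z <= r -> Cmod w <= r ->
  Cmod (remainder a b F z - remainder a b F w)%C <= lipschitz_bound p M r * Cmod (z - w)%C.
Proof.
intros Hp HF HM HM0 Hr1 Hz Hw.
assert (Hr : 0 <= r) by (eapply Rle_trans; [apply Cmod_ge_0|exact Hz]).
assert (HS : 0 <= higher_radial_sum p r) by now apply higher_radial_sum_nonneg.
set (S2 := higher_radial_sum p r) in *.
assert (Hgeom : forall N, (1 - r) * sum_n (G := R_AbelianMonoid)
   (fun k : nat => (if k then 0 else r ^ k) + 2 * S2 * r ^ k) N
   = r + 2 * S2 - (1 + 2 * S2) * r ^ S N).
{ induction N as [|N IH]; [rewrite sum_O; simpl; ring|].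
  rewrite sum_Sn. unfold plus; simpl AbelianMonoid.plus.
  match goal with |- (1 - r) * ?x = _ => change x with (sum_n (G := R_AbelianMonoid)
   (fun k : nat => (if k then 0 else r ^ k) + 2 * S2 * r ^ k) N + (r ^ S N + 2 * S2 * r ^ S N)) end.
  rewrite Rmult_plus_distr_l, IH. rewrite <- (tech_pow_Rmult r (S N)). ring. }
apply (is_series_C_bound (fun k => remainder_term p a b k z - remainder_term p a b k w)%C).
- apply (is_series_minus (K := C_AbsRing) (V := C_NormedModule)
    (fun k => remainder_term p a b k z) (fun k => remainder_term p a b k w));
    apply is_series_remainder; try assumption; unfold disk; lra.
- intros N.
  apply Rle_trans with (sum_n (G := R_AbelianMonoid) (fun k : nat => M * Cmod (z - w)%C *
    ((if k then 0 else r ^ k) + 2 * S2 * r ^ k)) N).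
  + apply sum_n_m_le_range. intros k _. now apply remainder_term_lipschitz.
  + rewrite (sum_n_mult_l (K := R_AbsRing)). unfold lipschitz_bound. fold S2.
    replace (M * (r + 2 * S2) / (1 - r) * Cmod (z - w)%C)
      with (M * Cmod (z - w)%C * ((r + 2 * S2) / (1 - r))) by (field; lra).
    apply Rmult_le_compat_l; [apply Rmult_le_pos; [exact HM0|apply Cmod_ge_0]|].
    apply Rmult_le_reg_l with (1 - r); [lra|].
    eapply Rle_trans; [apply Req_le, Hgeom|].
    replace ((1 - r) * ((r + 2 * S2) / (1 - r))) with (r + 2 * S2) by (field; lra).
    assert (0 <= r ^ S N) by now apply pow_le.
    assert (0 <= (1 + 2 * S2) * r ^ S N) by (apply Rmult_le_pos; lra). lra.
Qed.

(** The difference of the two sides has derivative r^(N+1) / (1 - r) and vanishes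
    at 0. *)
Lemma log_partial_sum_le (r : R) (N : nat) :
  0 <= r < 1 ->
  sum_n (G := R_AbelianMonoid) (fun k => r ^ S k / INR (S k)) N <= ln (1 / (1 - r)).
Proof.
intros Hr.
set (f := fun s => ln (1 / (1 - s)) - sum_n (G := R_AbelianMonoid) (fun k => s ^ S k / INR (S k)) N).
assert (Hgeom : forall s, (1 - s) * sum_n (G := R_AbelianMonoid) (fun k => s ^ k) N = 1 - s ^ S N).
{ intros s. induction N as [|N' IH]; [rewrite sum_O; simpl; ring|].
  rewrite sum_Sn.
  match goal with |- (1 - s) * ?x = _ => change x with
    (sum_n (G := R_AbelianMonoid) (fun k => s ^ k) N' + s ^ S N') end.
  rewrite Rmult_plus_distr_l, IH. rewrite <- (tech_pow_Rmult s (S N')). ring. }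
assert (Hf : forall s, s < 1 -> is_derive f s (s ^ S N / (1 - s))).
{ intros s Hs. unfold f.
  replace (s ^ S N / (1 - s)) with
    (1 / (1 - s) - sum_n (G := R_AbelianMonoid) (fun k => s ^ k) N).
  - apply (is_derive_minus (K := R_AbsRing) (V := R_NormedModule)).
    + auto_derive; [|field; lra]. repeat split; [lra|].
      apply Rdiv_lt_0_compat; lra.
    + apply (is_derive_sum_n (K := R_AbsRing) (V := R_NormedModule)
        (fun k s => s ^ S k / INR (S k))).
      intros k _. auto_derive; [trivial|]. simpl pred.
      assert (INR (S k) <> 0) by (apply not_0_INR; lia).
      change (match k with 0%nat => 1 | S _ => INR k + 1 end) with (INR (S k)). field. assumption.
  - apply Rmult_eq_reg_l with (1 - s); [|lra].
    rewrite Rmult_minus_distr_l, Hgeom. field. lra. }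
assert (H0 : f 0 = 0).
{ unfold f. replace (1 / (1 - 0)) with 1 by field. rewrite ln_1.
  replace (sum_n _ N) with (0 : R); [lra|]. symmetry.
  rewrite (sum_n_ext _ (fun _ => zero : R)).
  - apply (sum_n_m_const_zero (G := R_AbelianMonoid)).
  - intros k. rewrite pow_i by lia. unfold zero; simpl. unfold Rdiv. ring. }
assert (f 0 <= f r); [|unfold f in *; lra].
destruct (MVT_gen f 0 r (fun s => s ^ S N / (1 - s))) as [c [Hc E]].
- intros s Hs. rewrite Rmin_left, Rmax_right in Hs by lra. apply Hf. lra.
- intros s Hs. rewrite Rmin_left, Rmax_right in Hs by lra.
  apply continuity_pt_filterlim.
  apply (ex_derive_continuous (K := R_AbsRing) (V := R_NormedModule)).
  eexists. apply Hf. lra.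
- rewrite Rmin_left, Rmax_right in Hc by lra.
  assert (0 <= c ^ S N / (1 - c) * (r - 0)); [|lra].
  apply Rmult_le_pos; [|lra]. apply Rdiv_le_0_compat; [apply pow_le; lra|lra].
Qed.

Lemma remainder_term_bound (p : nat) (a b : nat -> nat -> C) (M r : R) (k : nat) (z : C) :
  (1 <= p)%nat -> coefficient_decay p a b M -> Cmod z <= r ->
  Cmod (remainder_term p a b k z)
  <= M * ((if k then 0 else r ^ S k / INR (S k))
          + higher_radial_sum p r * (r ^ S k / INR (S k))).
Proof.
intros Hp HM Hz. assert (Hr : 0 <= r) by (eapply Rle_trans; [apply Cmod_ge_0|exact Hz]).
assert (HSk : 0 < INR (S k)) by (apply lt_0_INR; lia).
assert (Hpow : forall e, 0 <= Cmod z ^ e <= r ^ e).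
{ intros e. split; [apply pow_le, Cmod_ge_0|].
  apply pow_incr. split; [apply Cmod_ge_0|exact Hz]. }
assert (Ht : forall n, (1 <= n <= p)%nat ->
  Cmod (RtoC (Cmod z ^ (2 * (n - 1))) * (a n (S k) * z ^ S k + Cconj (b n (S k) * z ^ S k)))%C
  <= M * (r ^ S k / INR (S k)) * r ^ (2 * (n - 1))).
{ intros n Hn. rewrite Cmod_mult, Cmod_R, Rabs_pos_eq by apply Hpow.
  rewrite Rmult_comm. apply Rmult_le_compat; [apply Cmod_ge_0|apply Hpow| |apply Hpow].
  eapply Rle_trans; [apply Cmod_triangle|].
  rewrite Cmod_conj, !Cmod_mult, !Cmod_pow.
  assert (Hc := HM n (S k) Hn ltac:(lia)).
  assert (Hc0 : 0 <= Cmod (a n (S k)) + Cmod (b n (S k))).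
  { pose proof (Cmod_ge_0 (a n (S k))); pose proof (Cmod_ge_0 (b n (S k))). lra. }
  assert (Hi : INR (S k) <= INR (n - 1 + S k)) by (apply le_INR; lia).
  assert (Hc1 : INR (S k) * (Cmod (a n (S k)) + Cmod (b n (S k))) <= M).
  { eapply Rle_trans; [|exact Hc]. now apply Rmult_le_compat_r. }
  replace (M * (r ^ S k / INR (S k))) with (M / INR (S k) * r ^ S k) by (field; lra).
  rewrite <- Rmult_plus_distr_r.
  apply Rmult_le_compat; [exact Hc0|apply Hpow| |apply Hpow].
  apply Rmult_le_reg_l with (INR (S k)); [exact HSk|].
  replace (INR (S k) * (M / INR (S k))) with M by (field; lra). exact Hc1. }
unfold remainder_term.
eapply Rle_trans; [apply Cmod_triangle|]. rewrite Rmult_plus_distr_l.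
apply Rplus_le_compat.
- destruct k as [|k]; [rewrite Cmod_0; lra|].
  specialize (Ht 1%nat ltac:(lia)).
  change (Cmod z ^ (2 * (1 - 1))) with 1 in Ht. change (r ^ (2 * (1 - 1))) with 1 in Ht.
  rewrite Cmult_1_l, Rmult_1_r in Ht. exact Ht.
- replace (M * (higher_radial_sum p r * (r ^ S k / INR (S k))))
    with (M * (r ^ S k / INR (S k)) * higher_radial_sum p r) by ring.
  rewrite <- higher_radial_sum_scal.
  eapply Rle_trans; [apply Cmod_sum_n_m_le|].
  apply sum_n_m_le_range. intros n Hn. apply Ht. lia.
Qed.

(** The sum over k of the bounds in [remainder_term_bound]: the decay M / j of the
    coefficients produces logarithms. *)
Definition size_bound (p : nat) (M r : R) : R :=
  M * (ln (1 / (1 - r)) - r + ln (1 / (1 - r)) * higher_radial_sum p r).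

Lemma remainder_bound (p : nat) (a b : nat -> nat -> C) (F : C -> C) (M r : R) (z : C) :
  (1 <= p)%nat -> almansi_expansion p a b F -> coefficient_decay p a b M ->
  0 <= M -> r < 1 -> Cmod z <= r ->
  Cmod (remainder a b F z) <= size_bound p M r.
Proof.
intros Hp HF HM HM0 Hr1 Hz.
assert (Hr : 0 <= r) by (eapply Rle_trans; [apply Cmod_ge_0|exact Hz]).
assert (Hz1 : disk 1 z) by (unfold disk; lra).
assert (HS : 0 <= higher_radial_sum p r) by now apply higher_radial_sum_nonneg.
set (S2 := higher_radial_sum p r) in *.
apply (is_series_C_bound _ _ _ (is_series_remainder p a b F z Hp HF Hz1)).
intros N.
apply Rle_trans with (sum_n (G := R_AbelianMonoid) (fun k : nat => M *
    ((if k then 0 else r ^ S k / INR (S k)) + S2 * (r ^ S k / INR (S k)))) N).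
- apply sum_n_m_le_range. intros k _. now apply remainder_term_bound.
- rewrite (sum_n_mult_l (K := R_AbsRing)). unfold size_bound. fold S2.
  apply Rmult_le_compat_l; [exact HM0|].
  assert (E : forall N, sum_n (G := R_AbelianMonoid) (fun k : nat =>
    (if k then 0 else r ^ S k / INR (S k)) + S2 * (r ^ S k / INR (S k))) N
    = (1 + S2) * sum_n (G := R_AbelianMonoid) (fun k => r ^ S k / INR (S k)) N - r).
  { induction N0 as [|N0 IH]; [rewrite !sum_O; simpl; field|].
    rewrite !sum_Sn.
    match goal with |- plus ?x ?y = _ * (plus ?x' ?y') - _ => change (x + y = (1 + S2) * (x' + y') - r) end.
    rewrite IH. ring. }
  eapply Rle_trans; [apply Req_le, E|].
  pose proof (log_partial_sum_le r N (conj Hr Hr1)) as Hl.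
  apply Rle_trans with ((1 + S2) * ln (1 / (1 - r)) - r); [|lra].
  apply Rplus_le_compat_r. apply Rmult_le_compat_l; lra.
Qed.

(** * The linear part *)

Lemma linear_part_minus (a b : nat -> nat -> C) (z w : C) :
  (linear_part a b z - linear_part a b w)%C = linear_part a b (z - w)%C.
Proof. unfold linear_part. rewrite !Cmult_conj, Cminus_conj. ring. Qed.

Lemma Cmod_linear_part_ge (a b : nat -> nat -> C) (z : C) :
  Rabs (Cmod (a 1%nat 1%nat) - Cmod (b 1%nat 1%nat)) * Cmod z <= Cmod (linear_part a b z).
Proof.
unfold linear_part. set (x := (a 1%nat 1%nat * z)%C). set (y := Cconj (b 1%nat 1%nat * z)%C).
rewrite <- (Rabs_pos_eq (Cmod z)) by apply Cmod_ge_0. rewrite <- Rabs_mult.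
replace ((Cmod (a 1%nat 1%nat) - Cmod (b 1%nat 1%nat)) * Cmod z) with (Cmod x - Cmod y).
- apply Rabs_le. split.
  + assert (Cmod y <= Cmod (x + y)%C + Cmod x); [|lra].
    rewrite <- (Cmod_opp x). replace y with ((x + y) + - x)%C at 1 by ring. apply Cmod_triangle.
  + assert (Cmod x <= Cmod (x + y)%C + Cmod y); [|lra].
    rewrite <- (Cmod_opp y). replace x with ((x + y) + - y)%C at 1 by ring. apply Cmod_triangle.
- unfold x, y. rewrite Cmod_conj, !Cmod_mult. ring.
Qed.

(** The inverse is y |-> (conj c y - conj d conj y) / (|c|^2 - |d|^2) for the linear
    part c z + conj (d z). *)
Lemma linear_part_surjective (a b : nat -> nat -> C) (y : C) :
  Cmod (a 1%nat 1%nat) <> Cmod (b 1%nat 1%nat) -> { z | linear_part a b z = y }.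
Proof.
set (c := a 1%nat 1%nat). set (d := b 1%nat 1%nat). intros Hne.
set (delta := (c * Cconj c - d * Cconj d)%C).
assert (Hd : delta = RtoC (Cmod c ^ 2 - Cmod d ^ 2)).
{ unfold delta. rewrite <- !Cmod2_conj, RtoC_minus. reflexivity. }
assert (Hd0 : delta <> RtoC 0).
{ rewrite Hd. intros E. injection E as E. apply Hne.
  pose proof (Cmod_ge_0 c). pose proof (Cmod_ge_0 d). nra. }
assert (Hdc : Cconj delta = delta).
{ rewrite Hd. unfold Cconj, RtoC; simpl fst; simpl snd. now rewrite Ropp_0. }
exists ((Cconj c * y - Cconj d * Cconj y) / delta)%C.
unfold linear_part. fold c d.
rewrite Cmult_conj, Cdiv_conj, Hdc, Cminus_conj, !Cmult_conj, !Cconj_conj by assumption.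
transitivity (delta * y / delta)%C; [unfold delta; field; exact Hd0|field; exact Hd0].
Qed.

Lemma is_derive_0_of_quadratic (f : R -> R) (B d : R) :
  0 < d -> (forall x, Rabs x < d -> Rabs (f x - f 0) <= B * x ^ 2) -> is_derive f 0 0.
Proof.
intros Hd Hf. apply is_derive_Reals. intros eps Heps.
set (e := Rmin d (eps / (Rabs B + 1))).
assert (HB : 0 < Rabs B + 1) by (pose proof (Rabs_pos B); lra).
assert (He : 0 < e) by (apply Rmin_pos; [exact Hd|now apply Rdiv_lt_0_compat]).
exists (mkposreal e He). intros x Hx Hxe. simpl in Hxe.
rewrite Rplus_0_l, Rminus_0_r.
assert (H1 : Rabs x < d) by (eapply Rlt_le_trans; [exact Hxe|apply Rmin_l]).
assert (H2 : Rabs x < eps / (Rabs B + 1)) by (eapply Rlt_le_trans; [exact Hxe|apply Rmin_r]).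
specialize (Hf x H1).
assert (Hx0 : 0 < Rabs x) by now apply Rabs_pos_lt.
unfold Rdiv. rewrite Rabs_mult, Rabs_inv.
apply Rmult_lt_reg_r with (Rabs x); [exact Hx0|].
rewrite Rmult_assoc, Rinv_l, Rmult_1_r by lra.
eapply Rle_lt_trans; [exact Hf|].
assert (E : x ^ 2 = Rabs x * Rabs x) by (rewrite <- Rabs_mult, Rabs_pos_eq; simpl; [ring|nra]).
rewrite E, <- Rmult_assoc. apply Rmult_lt_compat_r; [exact Hx0|].
apply Rle_lt_trans with (Rabs B * Rabs x).
- apply Rmult_le_compat_r; [lra|apply Rle_abs].
- apply Rlt_le_trans with ((Rabs B + 1) * Rabs x); [lra|].
  apply Rmult_le_reg_r with (/ (Rabs B + 1)); [now apply Rinv_0_lt_compat|].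
  replace ((Rabs B + 1) * Rabs x * / (Rabs B + 1)) with (Rabs x) by (field; lra).
  apply Rlt_le. exact H2.
Qed.

Lemma higher_radial_sum_le (p : nat) (r : R) :
  0 <= r <= 1 -> higher_radial_sum p r <= INR p * r.
Proof.
intros Hr. unfold higher_radial_sum.
apply Rle_trans with (sum_n_m (G := R_AbelianMonoid) (fun _ => r) 2 p).
- apply sum_n_m_le_range. intros n Hn.
  replace (2 * (n - 1))%nat with (S (2 * (n - 1) - 1)) by lia.
  rewrite <- tech_pow_Rmult. rewrite <- (Rmult_1_r r) at 3.
  apply Rmult_le_compat_l; [lra|]. rewrite <- (pow1 (2 * (n - 1) - 1)).
  apply pow_incr. lra.
- rewrite sum_n_m_const. apply Rmult_le_compat_r; [lra|]. apply le_INR. lia.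
Qed.

Lemma lipschitz_bound_le (p : nat) (M r : R) :
  0 <= M -> 0 <= r <= 1 / 2 -> lipschitz_bound p M r <= 2 * M * (1 + 2 * INR p) * r.
Proof.
intros HM Hr. unfold lipschitz_bound.
pose proof (higher_radial_sum_le p r ltac:(lra)) as HS.
apply Rle_div_l; [lra|].
apply Rle_trans with (M * ((1 + 2 * INR p) * r)).
- apply Rmult_le_compat_l; lra.
- assert (0 <= M * ((1 + 2 * INR p) * r)).
  { apply Rmult_le_pos; [exact HM|]. apply Rmult_le_pos; [|lra]. pose proof (pos_INR p). lra. }
  replace (2 * M * (1 + 2 * INR p) * r * (1 - r))
    with (M * ((1 + 2 * INR p) * r) * (2 * (1 - r))) by ring.
  rewrite <- (Rmult_1_r (M * _)) at 1. apply Rmult_le_compat_l; lra.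
Qed.

Lemma remainder_quadratic (p : nat) (a b : nat -> nat -> C) (F : C -> C) (M : R) (z : C) :
  (1 <= p)%nat -> almansi_expansion p a b F -> coefficient_decay p a b M ->
  0 <= M -> Cmod z <= 1 / 2 ->
  Cmod (remainder a b F z - remainder a b F 0)%C <= 2 * M * (1 + 2 * INR p) * Cmod z ^ 2.
Proof.
intros Hp HF HM HM0 Hz.
eapply Rle_trans.
- apply (remainder_lipschitz p a b F M (Cmod z) z 0); try assumption; [lra|lra|].
  rewrite Cmod_0. apply Cmod_ge_0.
- replace (z - 0)%C with z by ring.
  replace (2 * M * (1 + 2 * INR p) * Cmod z ^ 2)
    with (2 * M * (1 + 2 * INR p) * Cmod z * Cmod z) by ring.
  apply Rmult_le_compat_r; [apply Cmod_ge_0|].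
  apply lipschitz_bound_le; [exact HM0|]. split; [apply Cmod_ge_0|exact Hz].
Qed.

Lemma Derive_of_quadratic_error (f : R -> R) (l c B : R) :
  (forall x, Rabs x < 1 / 2 -> Rabs ((f x - l * x - c) - (f 0 - c)) <= B * x ^ 2) ->
  Derive f 0 = l.
Proof.
intros Hf. assert (H1 : is_derive (fun x => f x - l * x - c) 0 0).
{ apply (is_derive_0_of_quadratic _ B (1 / 2)); [lra|].
  intros x Hx. replace (f 0 - l * 0 - c) with (f 0 - c) by ring. now apply Hf. }
assert (H2 : is_derive (fun x => l * x + c) 0 l) by (auto_derive; [trivial|ring]).
pose proof (is_derive_plus (K := R_AbsRing) (V := R_NormedModule) _ _ _ _ _ H1 H2) as H.
apply is_derive_unique in H. rewrite (Derive_ext _ f) in H.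
- rewrite H. apply Rplus_0_l.
- intros x. unfold plus; simpl. ring.
Qed.

(** The remainder is quadratic at 0, so F has there the partial derivatives of its
    linear part. *)
Lemma lambda_at_0 (p : nat) (a b : nat -> nat -> C) (F : C -> C) (M : R) :
  (1 <= p)%nat -> almansi_expansion p a b F -> coefficient_decay p a b M -> 0 <= M ->
  lambda F (RtoC 0) = Rabs (Cmod (a 1%nat 1%nat) - Cmod (b 1%nat 1%nat)).
Proof.
intros Hp HF HM HM0.
assert (Hq : forall z : C, Cmod z < 1 / 2 ->
  Cmod (remainder a b F z - remainder a b F 0)%C <= 2 * M * (1 + 2 * INR p) * Cmod z ^ 2)
  by (intros z Hz; apply remainder_quadratic; try assumption; lra).
unfold remainder in Hq.
assert (Hx : forall x : R, Cmod (x, 0) = Rabs x) by (intros x; apply Cmod_R).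
assert (Hy : forall y : R, Cmod (0, y) = Rabs y).
{ intros y. replace ((0, y) : C) with (Ci * RtoC y)%C by (apply injective_projections; simpl; ring).
  rewrite Cmod_mult, Cmod_Ci, Cmod_R. ring. }
assert (Hsq : forall x : R, Rabs x ^ 2 = x ^ 2) by (intros x; apply pow2_abs).
unfold linear_part in Hq.
set (c := a 1%nat 1%nat) in *. set (d := b 1%nat 1%nat) in *.
destruct c as [c1 c2]. destruct d as [d1 d2].
set (B := 2 * M * (1 + 2 * INR p)) in *.
assert (Im_le : forall z : C, Rabs (Im z) <= Cmod z)
  by (intros z; eapply Rle_trans; [apply Rmax_r|apply Rmax_Cmod]).
assert (X1 : Derive (fun x => Re (F (x, 0))) 0 = c1 + d1).
{ apply (Derive_of_quadratic_error _ _ 0 B). intros x Hxd.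
  specialize (Hq (x, 0)). rewrite Hx, Hsq in Hq.
  eapply Rle_trans; [|apply Hq, Hxd]. eapply Rle_trans; [|apply re_le_Cmod].
  apply Req_le. f_equal. unfold RtoC, Re; simpl. ring. }
assert (X2 : Derive (fun x => Im (F (x, 0))) 0 = c2 - d2).
{ apply (Derive_of_quadratic_error _ _ 0 B). intros x Hxd.
  specialize (Hq (x, 0)). rewrite Hx, Hsq in Hq.
  eapply Rle_trans; [|apply Hq, Hxd]. eapply Rle_trans; [|apply Im_le].
  apply Req_le. f_equal. unfold RtoC, Im; simpl. ring. }
assert (Y1 : Derive (fun y => Re (F (0, y))) 0 = - c2 - d2).
{ apply (Derive_of_quadratic_error _ _ 0 B). intros x Hxd.
  specialize (Hq (0, x)). rewrite Hy, Hsq in Hq.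
  eapply Rle_trans; [|apply Hq, Hxd]. eapply Rle_trans; [|apply re_le_Cmod].
  apply Req_le. f_equal. unfold RtoC, Re; simpl. ring. }
assert (Y2 : Derive (fun y => Im (F (0, y))) 0 = c1 - d1).
{ apply (Derive_of_quadratic_error _ _ 0 B). intros x Hxd.
  specialize (Hq (0, x)). rewrite Hy, Hsq in Hq.
  eapply Rle_trans; [|apply Hq, Hxd]. eapply Rle_trans; [|apply Im_le].
  apply Req_le. f_equal. unfold RtoC, Im; simpl. ring. }
unfold lambda.
replace (dz F 0) with ((c1, c2) : C).
- replace (dzbar F 0) with (Cconj (d1, d2)); [now rewrite Cmod_conj|].
  unfold dzbar, Cdx, Cdy, RtoC, Re, Im, Cconj in *; simpl in *.
  rewrite X1, X2, Y1, Y2. apply injective_projections; simpl; field.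
- unfold dz, Cdx, Cdy, RtoC, Re, Im, Cconj in *; simpl in *.
  rewrite X1, X2, Y1, Y2. apply injective_projections; simpl; field.
Qed.

(** * Univalence and covering *)

(** Where two values of F agree, the linear part must be compensated by the
    remainder, which is too flat for it. *)
Lemma univalent_on_disk (p : nat) (a b : nat -> nat -> C) (F : C -> C) (M alpha r2 : R) :
  (1 <= p)%nat -> almansi_expansion p a b F -> coefficient_decay p a b M -> 0 <= M ->
  Rabs (Cmod (a 1%nat 1%nat) - Cmod (b 1%nat 1%nat)) = alpha -> r2 < 1 ->
  (forall r, 0 <= r < r2 -> lipschitz_bound p M r < alpha) ->
  univalent_on F (disk r2).
Proof.
intros Hp HF HM HM0 Ha Hr2 Hlip z w Hz Hw E.
unfold disk in Hz, Hw.
set (r := Rmax (Cmod z) (Cmod w)).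
assert (Hr : 0 <= r < r2).
{ split; [eapply Rle_trans; [apply Cmod_ge_0|apply Rmax_l]|now apply Rmax_lub_lt]. }
pose proof (remainder_lipschitz p a b F M r z w Hp HF HM HM0 ltac:(lra) (Rmax_l _ _) (Rmax_r _ _)) as Hl.
pose proof (Cmod_linear_part_ge a b (z - w)%C) as Hg.
rewrite Ha, <- linear_part_minus in Hg.
replace (remainder a b F z - remainder a b F w)%C
  with (- (linear_part a b z - linear_part a b w))%C in Hl
  by (unfold remainder; rewrite E; ring).
rewrite Cmod_opp in Hl. specialize (Hlip r Hr).
assert (H0 : Cmod (z - w)%C = 0).
{ pose proof (Cmod_ge_0 (z - w)%C) as Hc. apply Rle_antisym; [|exact Hc].
  apply Rnot_lt_le. intros Hlt.
  assert (lipschitz_bound p M r * Cmod (z - w)%C < alpha * Cmod (z - w)%C)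
    by now apply Rmult_lt_compat_r. lra. }
apply Cmod_eq_0 in H0. replace z with ((z - w) + w)%C by ring. rewrite H0. ring.
Qed.

(** The contraction principle: the iterates of 0 converge, their increments being
    dominated by a geometric series. *)
Lemma contraction_fixed_point (T : C -> C) (r q : R) :
  0 <= r -> 0 <= q < 1 ->
  (forall z, Cmod z <= r -> Cmod (T z) <= r) ->
  (forall z w, Cmod z <= r -> Cmod w <= r -> Cmod (T z - T w)%C <= q * Cmod (z - w)%C) ->
  exists z, Cmod z <= r /\ T z = z.
Proof.
intros Hr Hq HT HL.
set (x := fun n => Nat.iter n T (RtoC 0)).
assert (Hx : forall n, Cmod (x n) <= r).
{ induction n as [|n IH]; [simpl; now rewrite Cmod_0|]. now apply HT. }
assert (Hstep : forall n, Cmod (x (S n) - x n)%C <= Cmod (x 1%nat - x 0%nat)%C * q ^ n).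
{ induction n as [|n IH]; [simpl; lra|].
  change (Cmod (T (x (S n)) - T (x n))%C <= Cmod (x 1%nat - x 0%nat)%C * q ^ S n).
  eapply Rle_trans; [apply HL; apply Hx|]. rewrite <- tech_pow_Rmult.
  replace (Cmod (x 1%nat - x 0%nat)%C * (q * q ^ n))
    with (q * (Cmod (x 1%nat - x 0%nat)%C * q ^ n)) by ring.
  now apply Rmult_le_compat_l. }
assert (Hsum : forall n, sum_n (G := C_AbelianMonoid) (fun k => x (S k) - x k)%C n = x (S n)).
{ induction n as [|n IH].
  - rewrite sum_O. simpl. ring.
  - rewrite sum_Sn, IH. change (x (S n) + (x (S (S n)) - x (S n)) = x (S (S n)))%C. ring. }
destruct (ex_series_le (K := C_AbsRing) (V := C_CompleteNormedModule)
  (fun k => x (S k) - x k)%C _ Hstep) as [l Hl].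
{ apply (ex_series_scal_l (K := R_AbsRing) (V := R_NormedModule)
    (Cmod (x 1%nat - x 0%nat)%C) (fun k => q ^ k)).
  exists (/ (1 - q)). apply is_series_geom. rewrite Rabs_pos_eq; lra. }
apply is_series_Cmod_converges in Hl.
assert (Hlr : Cmod l <= r).
{ replace l with (l - 0)%C by Cring. apply (Cmod_converges_bound _ _ _ _ 0 Hl).
  intros n _. rewrite Hsum. replace (x (S n) - 0)%C with (x (S n)) by ring. apply Hx. }
exists l. split; [exact Hlr|].
assert (H0 : Cmod (l - T l)%C <= 0).
{ apply le_epsilon. intros eps Heps. rewrite Rplus_0_l.
  destruct (Hl eps Heps) as [N HN].
  apply (Cmod_converges_bound _ _ _ _ (S N) Hl).
  intros n Hn. destruct n as [|n]; [lia|]. rewrite Hsum.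
  change (Cmod (T (x (S n)) - T l)%C <= eps).
  eapply Rle_trans; [apply HL; [apply Hx|exact Hlr]|].
  specialize (HN n ltac:(lia)). rewrite Hsum in HN.
  pose proof (Cmod_ge_0 (x (S n) - l)%C).
  apply Rle_trans with (1 * Cmod (x (S n) - l)%C); [|lra].
  apply Rmult_le_compat_r; lra. }
assert (E : (l - T l)%C = RtoC 0) by (apply Cmod_eq_0, Rle_antisym; [exact H0|apply Cmod_ge_0]).
replace (T l) with (l - (l - T l))%C by Cring. rewrite E. Cring.
Qed.

(** F z = w means that z is a fixed point of z |-> G (w - remainder z), where G
    inverts the linear part and so has Lipschitz constant at most 1 / alpha. *)
Lemma covers_point (p : nat) (a b : nat -> nat -> C) (F : C -> C) (M alpha r : R) (w : C) :
  (1 <= p)%nat -> almansi_expansion p a b F -> coefficient_decay p a b M -> 0 <= M ->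
  Rabs (Cmod (a 1%nat 1%nat) - Cmod (b 1%nat 1%nat)) = alpha -> 0 < alpha -> 0 <= r < 1 ->
  lipschitz_bound p M r < alpha -> Cmod w <= alpha * r - size_bound p M r ->
  exists z, Cmod z <= r /\ F z = w.
Proof.
intros Hp HF HM HM0 Ha Hal Hr Hlip Hw.
assert (Hne : Cmod (a 1%nat 1%nat) <> Cmod (b 1%nat 1%nat)).
{ intros E. rewrite E, Rminus_diag, Rabs_R0 in Ha. lra. }
set (G := fun y => proj1_sig (linear_part_surjective a b y Hne)).
assert (HG : forall y, linear_part a b (G y) = y)
  by (intros y; unfold G; apply proj2_sig).
assert (HGl : forall y y', alpha * Cmod (G y - G y')%C <= Cmod (y - y')%C).
{ intros y y'. rewrite <- Ha. eapply Rle_trans; [apply Cmod_linear_part_ge|].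
  rewrite <- linear_part_minus, !HG. apply Rle_refl. }
assert (HG0 : forall y, alpha * Cmod (G y) <= Cmod y).
{ intros y. rewrite <- Ha. eapply Rle_trans; [apply Cmod_linear_part_ge|].
  rewrite HG. apply Rle_refl. }
assert (Hlip0 : 0 <= lipschitz_bound p M r).
{ unfold lipschitz_bound. apply Rdiv_le_0_compat; [|lra].
  apply Rmult_le_pos; [exact HM0|].
  pose proof (higher_radial_sum_nonneg p r (proj1 Hr)). lra. }
destruct (contraction_fixed_point (fun z => G (w - remainder a b F z)%C) r
  (lipschitz_bound p M r / alpha)) as [z [Hz Ez]].
- lra.
- split; [apply Rdiv_le_0_compat; assumption|].
  apply Rlt_div_l; [exact Hal|lra].
- intros z Hz. apply Rmult_le_reg_l with alpha; [exact Hal|].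
  eapply Rle_trans; [apply HG0|]. unfold Cminus.
  eapply Rle_trans; [apply Cmod_triangle|]. rewrite Cmod_opp.
  pose proof (remainder_bound p a b F M r z Hp HF HM HM0 (proj2 Hr) Hz). lra.
- intros z z' Hz Hz'. apply Rmult_le_reg_l with alpha; [exact Hal|].
  eapply Rle_trans; [apply HGl|].
  replace (w - remainder a b F z - (w - remainder a b F z'))%C
    with (- (remainder a b F z - remainder a b F z'))%C by ring.
  rewrite Cmod_opp.
  replace (alpha * (lipschitz_bound p M r / alpha * Cmod (z - z')%C))
    with (lipschitz_bound p M r * Cmod (z - z')%C) by (field; lra).
  apply (remainder_lipschitz p); try assumption; apply Hr.
- exists z. split; [exact Hz|].
  transitivity (linear_part a b z + remainder a b F z)%C; [unfold remainder; ring|].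
  rewrite <- Ez at 1. rewrite HG. ring.
Qed.

(** * The two radii *)

Lemma continuous_higher_radial_sum (p : nat) (r : R) : continuous (higher_radial_sum p) r.
Proof.
apply continuous_ext with (fun s => sum_n_m (G := R_AbelianMonoid)
  (fun n => 1 * s ^ (2 * (n - 1))) 2 p).
- intros s. etransitivity; [apply higher_radial_sum_scal|apply Rmult_1_l].
- apply (ex_derive_continuous (K := R_AbsRing) (V := R_NormedModule)).
  eexists. apply (is_derive_sum_pow (fun _ => 1) (fun n => 2 * (n - 1))%nat).
Qed.

Lemma higher_radial_sum_incr (p : nat) (r s : R) :
  0 <= r <= s -> higher_radial_sum p r <= higher_radial_sum p s.
Proof. intros H. apply sum_n_m_le_range. intros n _. now apply pow_incr. Qed.

(** Multiplied by 1 - r, the equation is between a decreasing and an increasing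
    function on [0, 1]; their order changes between the ends. *)
Lemma exists_radius (p : nat) (alpha M : R) :
  0 < alpha -> 0 < M ->
  exists r2, 0 < r2 < 1 /\
    alpha * (1 - r2) = M * (r2 + 3 * higher_radial_sum p r2) /\
    forall r, 0 <= r < r2 -> M * (r + 3 * higher_radial_sum p r) < alpha * (1 - r).
Proof.
intros Ha HM.
set (f := fun r => M * (r + 3 * higher_radial_sum p r) - alpha * (1 - r)).
assert (Hc : forall r, continuous f r).
{ intros r. unfold f.
  apply (continuous_minus (V := R_NormedModule)).
  - apply (continuous_scal_r (K := R_AbsRing) (V := R_NormedModule)).
    apply (continuous_plus (V := R_NormedModule)); [apply continuous_id|].
    apply (continuous_scal_r (K := R_AbsRing) (V := R_NormedModule)).
    apply continuous_higher_radial_sum.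
  - apply (ex_derive_continuous (K := R_AbsRing) (V := R_NormedModule)). auto_derive; trivial. }
assert (Hmono : forall r s, 0 <= r < s -> f r < f s).
{ intros r s H. unfold f. pose proof (higher_radial_sum_incr p r s ltac:(lra)).
  assert (M * (r + 3 * higher_radial_sum p r) < M * (s + 3 * higher_radial_sum p s))
    by (apply Rmult_lt_compat_l; lra).
  assert (alpha * (1 - s) < alpha * (1 - r)) by (apply Rmult_lt_compat_l; lra). lra. }
assert (H0 : f 0 < 0).
{ unfold f. replace (higher_radial_sum p 0) with 0; [lra|]. symmetry.
  apply Rle_antisym.
  - pose proof (higher_radial_sum_le p 0 ltac:(lra)). lra.
  - apply higher_radial_sum_nonneg. lra. }
assert (H1 : 0 < f 1).
{ unfold f. pose proof (higher_radial_sum_nonneg p 1 ltac:(lra)).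
  assert (0 < M * (1 + 3 * higher_radial_sum p 1)) by (apply Rmult_lt_0_compat; lra). lra. }
destruct (IVT_gen f 0 1 0) as [r2 [Hr2 E]].
- intros r. apply continuity_pt_filterlim. apply Hc.
- rewrite Rmin_left, Rmax_right; lra.
- rewrite Rmin_left, Rmax_right in Hr2 by lra.
  exists r2. split; [|split].
  + split.
    * destruct (Req_dec r2 0) as [Z|Z]; [subst r2; lra|lra].
    * destruct (Req_dec r2 1) as [Z|Z]; [subst r2; lra|lra].
  + unfold f in E. lra.
  + intros r Hr. specialize (Hmono r r2 Hr). unfold f in *. lra.
Qed.

Lemma log_lt (r : R) : 0 < r < 1 -> 0 < ln (1 / (1 - r)) < r / (1 - r).
Proof.
intros Hr. set (x := ln (1 / (1 - r))).
assert (Hp : 1 < 1 / (1 - r)) by (apply Rlt_div_r; lra).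
assert (Hx : 0 < x) by (unfold x; rewrite <- ln_1; apply ln_increasing; lra).
split; [exact Hx|].
assert (E : exp x = 1 / (1 - r)) by (unfold x; apply exp_ln; lra).
pose proof (exp_ineq1 x ltac:(lra)) as He. rewrite E in He.
replace (r / (1 - r)) with (1 / (1 - r) - 1) by (field; lra). lra.
Qed.

(** Replacing alpha by its value from the equation for r, the claim follows from
    log (1/(1-r)) < r / (1 - r). *)
Lemma covered_radius_pos (p : nat) (alpha M r : R) :
  0 < M -> 0 < r < 1 -> alpha * (1 - r) = M * (r + 3 * higher_radial_sum p r) ->
  0 < alpha * r - M * (ln (1 / (1 - r)) - r + 2 * ln (1 / (1 - r)) * higher_radial_sum p r).
Proof.
intros HM Hr E.
pose proof (higher_radial_sum_nonneg p r ltac:(lra)) as HS.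
set (S2 := higher_radial_sum p r) in *.
destruct (log_lt r Hr) as [Hl0 Hl]. set (l := ln (1 / (1 - r))) in *.
assert (Ea : alpha = M * (r + 3 * S2) / (1 - r)).
{ apply Rmult_eq_reg_r with (1 - r); [|lra]. rewrite E. field. lra. }
replace (alpha * r - M * (l - r + 2 * l * S2))
  with (M * ((r / (1 - r) - l) + S2 * (2 * (r / (1 - r) - l) + r / (1 - r))))
  by (rewrite Ea; field; lra).
apply Rmult_lt_0_compat; [exact HM|].
assert (0 <= S2 * (2 * (r / (1 - r) - l) + r / (1 - r))); [|lra].
apply Rmult_le_pos; lra.
Qed.

Lemma continuous_size_bound (p : nat) (M r : R) : r < 1 -> continuous (size_bound p M) r.
Proof.
intros Hr.
assert (Hl : continuous (fun s => ln (1 / (1 - s))) r).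
{ apply (ex_derive_continuous (K := R_AbsRing) (V := R_NormedModule)). auto_derive.
  repeat split; [lra|]. apply Rdiv_lt_0_compat; lra. }
unfold size_bound.
apply (continuous_scal_r (K := R_AbsRing) (V := R_NormedModule)).
apply (continuous_plus (V := R_NormedModule)).
- apply (continuous_minus (V := R_NormedModule)); [exact Hl|apply continuous_id].
- apply (continuous_mult (K := R_AbsRing)); [exact Hl|apply continuous_higher_radial_sum].
Qed.

Lemma exists_smaller_radius (f : R -> R) (r x : R) :
  continuous f r -> 0 < r -> x < f r -> exists s, 0 <= s < r /\ x < f s.
Proof.
intros Hf Hr Hx.
destruct (Hf (fun y => x < y)) as [d Hd]; [now apply open_gt|].
set (e := Rmin d r / 2).
assert (He : 0 < Rmin d r) by (apply Rmin_pos; [apply cond_pos|exact Hr]).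
pose proof (Rmin_l d r). pose proof (Rmin_r d r).
exists (r - e). split; [unfold e; lra|].
apply Hd. unfold ball; simpl. unfold AbsRing_ball, abs, minus, plus, opp; simpl.
replace (r - e + - r) with (- e) by ring. rewrite Rabs_Ropp, Rabs_pos_eq; unfold e; lra.
Qed.

Lemma circle_length_le_sup (F : C -> C) :
  Rbar_lt (circle_length_1 F) p_infty ->
  forall r, 0 < r < 1 -> circle_length F r <= real (circle_length_1 F).
Proof.
intros Hl r Hr.
assert (H := proj1 (Lub_Rbar_correct _) (circle_length F r)
  : (exists s, 0 < s < 1 /\ circle_length F r = circle_length F s) ->
    Rbar_le (circle_length F r) (circle_length_1 F)).
specialize (H (ex_intro _ r (conj Hr eq_refl))).
destruct (circle_length_1 F) as [l| |]; simpl in *; [exact H|easy|easy].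
Qed.

Theorem theorem4 (p : nat) (K alpha : R) (F : C -> C)
    (h g : nat -> C -> C) (a b : nat -> nat -> C)
    (hp : (1 <= p)%nat) (hK : 1 <= K)
    (hh : forall n : nat, (1 <= n <= p)%nat -> forall z : C, disk 1 z ->
      is_series (K := C_AbsRing) (V := C_NormedModule)
        (fun j : nat => (a n (S j) * z ^ S j)%C) (h n z))
    (hg : forall n : nat, (1 <= n <= p)%nat -> forall z : C, disk 1 z ->
      is_series (K := C_AbsRing) (V := C_NormedModule)
        (fun j : nat => (b n (S j) * z ^ S j)%C) (g n z))
    (hF : forall z : C, disk 1 z ->
      F z = sum_n_m (G := C_AbelianMonoid)
        (fun n : nat => (RtoC (Cmod z ^ (2 * (n - 1))) * (h n z + Cconj (g n z)))%C) 1 p)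
    (hpoly : polyharmonic p (disk 1) F)
    (hqr : quasiregular K F)
    (hlambda : lambda F (RtoC 0) = alpha) (halpha : 0 < alpha)
    (hl : Rbar_lt (circle_length_1 F) p_infty)
    (harga : forall j n1 n2 : nat,
      (1 <= j)%nat -> (1 <= n1 <= p)%nat -> (1 <= n2 <= p)%nat ->
      a n1 j <> RtoC 0 -> a n2 j <> RtoC 0 ->
      Rabs (Carg (a n1 j / a n2 j)%C) = 0)
    (hargb : forall j n1 n2 : nat,
      (1 <= j)%nat -> (1 <= n1 <= p)%nat -> (1 <= n2 <= p)%nat ->
      b n1 j <> RtoC 0 -> b n2 j <> RtoC 0 ->
      Rabs (Carg (b n1 j / b n2 j)%C) = 0) :
  let L : R := real (circle_length_1 F) in
  let S2 : R -> R := fun r =>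
    sum_n_m (G := R_AbelianMonoid) (fun n : nat => r ^ (2 * (n - 1))) 2 p in
  exists r2 : R,
    least_positive_root (fun r => r <> 1)
      (fun r => alpha - K * L / (2 * PI * (1 - r)) * (r + 3 * S2 r)) r2 /\
    let rho2 : R :=
      alpha * r2 - K * L / (2 * PI) *
        (ln (1 / (1 - r2)) - r2 + 2 * ln (1 / (1 - r2)) * S2 r2) in
    univalent_on F (disk r2) /\
    contains_univalent_disk F r2 rho2.
Proof.
intros L S2.
pose proof PI_RGT_0 as HPI.
set (M := K * L / (2 * PI)).
assert (HF : almansi_expansion p a b F) by now apply almansi_expansion_of_components with h g.
assert (HM : coefficient_decay p a b M).
{ intros n j Hn Hj. apply coefficient_bound with p (2 * p)%nat F; try assumption; try lia.
  - apply hpoly.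
  - lra.
  - now apply circle_length_le_sup. }
set (c := Cmod (a 1%nat 1%nat)) in *. set (d := Cmod (b 1%nat 1%nat)).
assert (Hcd : c + d <= M).
{ assert (Hc := HM 1%nat 1%nat ltac:(lia) ltac:(lia)). simpl in Hc. fold c d in Hc. lra. }
assert (Hc0 : 0 <= c) by apply Cmod_ge_0. assert (Hd0 : 0 <= d) by apply Cmod_ge_0.
assert (Ha : Rabs (c - d) = alpha).
{ rewrite <- hlambda. symmetry. apply lambda_at_0 with p M; try assumption. lra. }
assert (HM0 : 0 < M).
{ eapply Rlt_le_trans; [exact halpha|]. rewrite <- Ha. eapply Rle_trans; [|exact Hcd].
  apply Rabs_le. lra. }
destruct (exists_radius p alpha M halpha HM0) as [r2 [Hr2 [E Hlt]]].
assert (Hroot : forall r, r <> 1 ->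
  alpha - K * L / (2 * PI * (1 - r)) * (r + 3 * S2 r)
  = (alpha * (1 - r) - M * (r + 3 * higher_radial_sum p r)) / (1 - r)).
{ intros r Hr. unfold M, S2. fold (higher_radial_sum p r). field. split; [lra|].
  intros H; apply Hr; lra. }
assert (Hlip : forall r, 0 <= r < r2 -> lipschitz_bound p M r < alpha).
{ intros r Hr. unfold lipschitz_bound. apply Rlt_div_l; [lra|].
  eapply Rle_lt_trans; [|apply Hlt, Hr]. apply Rmult_le_compat_l; [lra|].
  pose proof (higher_radial_sum_nonneg p r (proj1 Hr)). lra. }
assert (Huni : univalent_on F (disk r2)).
{ apply univalent_on_disk with p a b M alpha; try assumption; lra. }
exists r2. split; [|split].
- split.
  + split; [lra|]. split; [lra|]. rewrite Hroot, E by lra. field. lra.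
  + intros s Hs Hs1 Es. apply Rnot_lt_le. intros Hlt2.
    specialize (Hlt s ltac:(lra)). rewrite Hroot in Es by assumption.
    assert (0 < (alpha * (1 - s) - M * (s + 3 * higher_radial_sum p s)) / (1 - s))
      by (apply Rdiv_lt_0_compat; lra). lra.
- exact Huni.
- split.
  + now apply covered_radius_pos.
  + match goal with |- context [disk ?rho _ <-> _] => set (rho2 := rho) end.
    exists (fun z => disk r2 z /\ disk rho2 (F z)). split; [|split].
    * now intros z [Hz _].
    * intros z w [Hz _] [Hw _]. now apply Huni.
    * intros w. split.
      -- intros Hw.
         destruct (exists_smaller_radius (fun r => alpha * r - size_bound p M r) r2 (Cmod w))
           as [r [Hr Hwr]].
         ++ apply (continuous_minus (V := R_NormedModule)).
            ** apply (continuous_scal_r (K := R_AbsRing) (V := R_NormedModule)), continuous_id.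
            ** apply continuous_size_bound. lra.
         ++ lra.
         ++ eapply Rlt_le_trans; [exact Hw|].
            unfold rho2, size_bound. fold M. unfold S2. fold (higher_radial_sum p r2).
            apply Rplus_le_compat_l, Ropp_le_contravar, Rmult_le_compat_l; [lra|].
            destruct (log_lt r2 Hr2) as [Hl0 _].
            pose proof (higher_radial_sum_nonneg p r2 ltac:(lra)).
            assert (0 <= ln (1 / (1 - r2)) * higher_radial_sum p r2)
              by (apply Rmult_le_pos; lra). lra.
         ++ destruct (covers_point p a b F M alpha r w) as [z [Hz Ez]];
              try assumption; try lra; [now apply Hlip|].
            exists z. rewrite Ez. split; [|reflexivity]. split; [|exact Hw].
            unfold disk. lra.
      -- now intros [z [[_ Hz] <-]].
Qed.
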